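(* Consider a type I model, and let $\mu$ be a probability measure on $\mathcal{X}_0$ such that $\mu^{\mathbb{Z}}(\mathcal{X}^* )=1$ and $\mathcal{T}\mu^{\mathbb{Z}}=\mu^{\mathbb{Z}}$. Suppose that for $\mathbf{P}_{\mu^{\mathbb{Z}}}$-almost every realization of $u_0=(u_0^t)_{t\in\mathbb{Z}}$ there exists at most one $x=(x^t)_{t\in\mathbb{Z}}\in\mathcal{X}_0^{\mathbb{Z}}$ such that $\check F^{(2)}(u_0^t,x^t)=x^{t+1}$ for all $t\in\mathbb{Z}$. Then $\mu^{\mathbb{Z}}$ is ergodic under $\mathcal{T}$.
   Context: Type I model: $\mathcal{X}_0,\mathcal{U}_0$ Polish spaces, $F:\mathcal{X}_0\times\mathcal{U}_0\to\mathcal{X}_0\times\mathcal{U}_0$ an involution, $F_n^t:=F$ for all $n,t\in\mathbb{Z}$. $\mathcal{X}^*$ is the set of $x=(x_n)_{n\in\mathbb{Z}}\in\mathcal{X}_0^{\mathbb{Z}}$ for which there is a unique family $(x_n^t,u_n^t)_{n,t\in\mathbb{Z}}$ with $F(x_n^t,u_{n-1}^t)=(x_n^{t+1},u_n^t)$ for all $n,t$ and $x_n^0=x_n$ for all $n$; $\mathcal{T}(x)_n:=x_n^1$. For a probability measure $P$ with $P(\mathcal{X}^* )=1$, $\mathbf{P}_P$ is the law of this family when $(x_n^0)_n\sim P$. The dual involution is $\check F:=\pi\circ F\circ\pi:\mathcal{U}_0\times\mathcal{X}_0\to\mathcal{U}_0\times\mathcal{X}_0$ with $\pi(a,b):=(b,a)$,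 and $\check F^{(2)}$ is its second coordinate. *)

(* Defs.v *)
From HB Require Import structures.
From mathcomp Require Import all_boot all_order all_algebra.
From mathcomp Require Import all_classical all_reals all_analysis.
From Stdlib Require Import ClassicalEpsilon.
Set Implicit Arguments. Unset Strict Implicit. Unset Printing Implicit Defensive.
Import Order.TTheory GRing.Theory Num.Theory.
Local Open Scope classical_set_scope.
Local Open Scope ring_scope.

Definition polish (R : realType) (T : topologicalType) : Prop :=
  exists d : T -> T -> R,
    (forall x y, 0 <= d x y) /\
        (forall x y, d x y = 0 <-> x = y) /\
        (forall x y, d x y = d y x) /\
        (forall x y z, d x z <= d x y + d y z) /\
        (forall A : set T, open A <->
           (forall x, A x -> exists2 e : R, 0 < e & [set y | d x y < e] `<=` A)) /\
        (forall u : nat -> T,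
           (forall e : R, 0 < e -> exists N, forall m n, (N <= m)%N -> (N <= n)%N ->
              d (u m) (u n) < e) ->
           exists l, forall e : R, 0 < e -> exists N, forall n, (N <= n)%N -> d (u n) l < e) /\
        (exists D : set T, countable D /\
           forall x (e : R), 0 < e -> exists2 y, D y & d x y < e).

Definition open_sets (X : topologicalType) : set (set X) := open.
Definition borel_sets (X : topologicalType) : set (set X) := smallest (sigma_algebra setT) (@open_sets X).
Definition borelT (X : ptopologicalType) := g_sigma_algebraType (@open_sets X).

Definition cylinders (X : ptopologicalType) : set (set (int -> X)) :=
  [set C | exists (n : int) (A : set X), borel_sets A /\
             C = (fun x : int -> X => x n) @^-1` A].

Definition seqZ (X : ptopologicalType) := g_sigma_algebraType (@cylinders X).

(* P is the product measure mu^Z: it is determined by its values on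
   finite-dimensional cylinders. *)
Definition is_product_measure (R : realType) (X : ptopologicalType)
    (mu : probability (borelT X) R) (P : probability (seqZ X) R) : Prop :=
  forall (s : seq int) (A : int -> set X),
    uniq s -> (forall n, borel_sets (A n)) ->
    P [set x : seqZ X | forall n, n \in s -> A n (x n)] =
    (\prod_(n <- s) mu (A n))%E.

Definition family_ok (X0 U0 : Type) (F : X0 * U0 -> X0 * U0)
    (x : int -> X0) (xs : int -> int -> X0) (us : int -> int -> U0) : Prop :=
  (forall n t : int, F (xs n t, us (n - 1) t) = (xs n (t + 1), us n t)) /\
  (forall n : int, xs n 0 = x n).

Definition Xstar (X0 U0 : Type) (F : X0 * U0 -> X0 * U0) : set (int -> X0) :=
  [set x | exists xs us, family_ok F x xs us /\
     forall xs' us', family_ok F x xs' us' -> xs' = xs /\ us' = us].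

(* A chosen family (the unique one when x is in Xstar). *)
Definition family_of (X0 U0 : Type) (F : X0 * U0 -> X0 * U0) (x : int -> X0)
  : option ((int -> int -> X0) * (int -> int -> U0)) :=
  epsilon (inhabits None)
    (fun o => match o with
              | Some p => family_ok F x p.1 p.2
              | None => False end).

(* The dynamics T(x)_n := x_n^1 (arbitrary, here identity, outside Xstar). *)
Definition Tmap (X0 U0 : Type) (F : X0 * U0 -> X0 * U0) (x : int -> X0)
  : int -> X0 :=
  match family_of F x with
  | Some p => fun n => p.1 n 1
  | None => x
  end.

Definition swap (A B : Type) (p : A * B) : B * A := (p.2, p.1).

Definition Fcheck (X0 U0 : Type) (F : X0 * U0 -> X0 * U0) : U0 * X0 -> U0 * X0 :=
  fun p => swap (F (swap p)).

Definition at_most_one_dual_orbit (X0 U0 : Type) (F : X0 * U0 -> X0 * U0)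
    (u : int -> U0) : Prop :=
  forall y z : int -> X0,
    (forall t : int, (Fcheck F (u t, y t)).2 = y (t + 1)) ->
    (forall t : int, (Fcheck F (u t, z t)).2 = z (t + 1)) ->
    y = z.

(* Main.v *)
Require Import Defs.
From HB Require Import structures.
From mathcomp Require Import all_boot all_order all_algebra.
From mathcomp Require Import all_classical all_reals all_analysis.
From mathcomp Require Import zify lra ring.
From Stdlib Require ClassicalEpsilon.
Import Order.TTheory GRing.Theory Num.Theory.
Local Open Scope classical_set_scope.
Local Open Scope ring_scope.

(* Cut the line at a site c.  Since F is an involution, the u_c^t with t >= 0
   are determined by the x_n with n <= c, and those with t < 0 by the x_n with
   n > c.  Under the product measure past and future of u_c are therefore
   independent, and T is the time shift.  Combining the past of u_c with the
   future given by a fixed left half, the uniqueness hypothesis shows that the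
   past of u_c alone determines (x_n)_{n > c}.  Hence an event A0 depending only
   on n > c is approximated by an event B on finitely many past times, and for
   m large {T^m x in B} depends only on n <= c, so it is independent of A0.  A
   T-invariant event A is approximated by such an A0, whence P A = (P A)^2.

   No measurability of F is assumed, so u_c need not be measurable.  It is
   replaced by theta, the right half of T(x) after the right half of x has been
   reset to a fixed configuration.  Turning "is determined by" into an
   approximation by finitely many events uses inner regularity: on a compact set
   where countably many given events are clopen, two disjoint compact sets that
   they separate pointwise are already separated by finitely many of them. *)

(** * Families and half-lines *)

Section Families.
Context {X0 U0 : Type}.
Variable (F : X0 * U0 -> X0 * U0).
Hypothesis Finv : forall p, F (F p) = p.
Implicit Types (x : int -> X0) (xs : int -> int -> X0) (us : int -> int -> U0).

Lemma family_unique x xs us xs' us' : Xstar F x ->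
  family_ok F x xs us -> family_ok F x xs' us' -> xs = xs' /\ us = us'.
Proof.
move=> [ys [vs [_ U]]] /U [-> ->] /U [-> ->]; by [].
Qed.

(** Times t >= 0 of a column with initial entry [a] and incoming values [u] from the left.
    [column_u] is what it passes on, and [columns_u c x u k] is what site c + k passes on when site
    c emits [u] and the sites to its right start from [x]. *)
Fixpoint column_x (a : X0) (u : nat -> U0) (t : nat) : X0 :=
  if t is s.+1 then (F (column_x a u s, u s)).1 else a.

Definition column_u (a : X0) (u : nat -> U0) (t : nat) : U0 :=
  (F (column_x a u t, u t)).2.

Fixpoint columns_u (c : int) x (u : nat -> U0) (k : nat) : nat -> U0 :=
  if k is j.+1 then column_u (x (c + j%:Z + 1)) (columns_u c x u j) else u.

(* For t >= 0 the entries left of a cut extend uniquely to the right by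
   recursion, so the upper half of the family of x may be replaced by any
   quadrant with the same initial row on the left of the cut. *)
Lemma upper_left_determined (c : int) x x' xs us xs' us' :
  Xstar F x -> family_ok F x xs us -> family_ok F x' xs' us' ->
  (forall n : int, n <= c -> x n = x' n) ->
  forall n t : int, n <= c -> 0 <= t -> xs n t = xs' n t /\ us n t = us' n t.
Proof.
move=> Sx [ok ok0] [ok' ok0'] xx'.
pose u0 (t : nat) := us' c t%:Z.
pose xs2 (n t : int) := if t < 0 then xs n t else if n <= c then xs' n t
  else column_x (x n) (columns_u c x u0 (absz (n - c - 1)%R)) (absz t).
pose us2 (n t : int) := if t < 0 then us n t else if n <= c then us' n t
  else columns_u c x u0 (absz (n - c)%R) (absz t).
have ok2 : family_ok F x xs2 us2.
  split; last first.
    by move=> n; rewrite /xs2 ltxx; case: ifPn => // nc; rewrite ok0' xx'.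
  move=> n t; have [t0|t0] := ltP t 0.
    rewrite /xs2 /us2 t0 ok.
    (* The seam is crossed only from time -1 to time 0, where the kept half and the new one share
       the row [x]. *)
    have [t1|t1] := ltP (t + 1) 0; first by [].
    have -> : t + 1 = 0 by lia.
    by case: ifPn => nc; rewrite ok0 // xx'// ok0'.
  have t1 : (t + 1 < 0) = false by lia.
  rewrite /xs2 /us2 t1 ltNge t0 /=.
  have [nc|nc] := leP n c.
    by have -> : n - 1 <= c by lia.
  have -> : (absz (t + 1)%R) = (absz t).+1 by lia.
  set k := (absz (n - c - 1)%R).
  have -> : (absz (n - c)%R) = k.+1 by rewrite /k; lia.
  have -> : (if n - 1 <= c then us' (n - 1) t
      else columns_u c x u0 (absz (n - 1 - c)%R) (absz t)) =
    columns_u c x u0 k (absz t).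
    case: ifPn => n1.
      have -> : k = 0%N by rewrite /k; lia.
      rewrite /= /u0; congr (us' _ _); lia.
    by congr (columns_u _ _ _ _ _); rewrite /k; lia.
  rewrite /= /column_u; have -> : c + k%:Z + 1 = n by rewrite /k; lia.
  by rewrite -surjective_pairing.
have [-> ->] := family_unique _ _ _ _ _ Sx (conj ok ok0) ok2.
by move=> n t nc t0; rewrite /xs2 /us2 ltNge t0 /= nc.
Qed.

(** Half-turn of space-time. [us n t] sits between sites n and n + 1 and between times t and t + 1,
    hence the extra - 1 in both arguments of [reflect_u]. *)
Definition reflect_x xs : int -> int -> X0 := fun n t => xs (- n) (- t).
Definition reflect_u us : int -> int -> U0 := fun n t => us (- n - 1) (- t - 1).

Lemma reflect_xK xs : reflect_x (reflect_x xs) = xs.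
Proof. by apply/funext => n; apply/funext => t; rewrite /reflect_x !opprK. Qed.

Lemma reflect_uK us : reflect_u (reflect_u us) = us.
Proof.
by apply/funext => n; apply/funext => t; rewrite /reflect_u; congr us; lia.
Qed.

(** Being an involution, F sends (x_n^(t+1), u_n^t) back to (x_n^t, u_(n-1)^t), which is the local
    rule for the turned family. *)
Lemma family_reflect x xs us : family_ok F x xs us ->
  family_ok F (fun n => x (- n)) (reflect_x xs) (reflect_u us).
Proof.
move=> [ok ok0]; split=> [n t|n]; last by rewrite /reflect_x oppr0 ok0.
rewrite /reflect_x /reflect_u.
have := ok (- n) (- t - 1).
rewrite (_ : - t - 1 + 1 = - t); last by lia.
rewrite (_ : - (n - 1) - 1 = - n); last by lia.
rewrite (_ : - (t + 1) = - t - 1); last by lia.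
by move=> <-; rewrite Finv.
Qed.

Lemma Xstar_reflect x : Xstar F x -> Xstar F (fun n => x (- n)).
Proof.
move=> [xs [us [ok U]]]; exists (reflect_x xs), (reflect_u us).
split; first exact: family_reflect.
move=> xs' us' ok'.
have := family_reflect _ _ _ ok'.
rewrite (_ : (fun n => _) = x); last by apply/funext => n; rewrite opprK.
by move=> /U [<- <-]; rewrite reflect_xK reflect_uK.
Qed.

(** This is [upper_left_determined] after the half-turn, which takes the sites n > c to sites up to
    - c - 1 and the times t < 0 of the u's to times - t - 1 >= 0. *)
Lemma lower_right_determined (c : int) x x' xs us xs' us' :
  Xstar F x -> family_ok F x xs us -> family_ok F x' xs' us' ->
  (forall n : int, c < n -> x n = x' n) ->
  forall n t : int, c <= n -> t < 0 -> us n t = us' n t.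
Proof.
move=> Sx ok ok' xx' n t nc t0.
have xx2 m : m <= - c - 1 -> x (- m) = x' (- m) by move=> ?; apply: xx'; lia.
have [||_] := upper_left_determined (- c - 1) _ _ _ _ _ _ (Xstar_reflect _ Sx)
  (family_reflect _ _ _ ok) (family_reflect _ _ _ ok') xx2 (- n - 1) (- t - 1);
  [lia|lia|].
rewrite /reflect_u.
have -> : - (- n - 1) - 1 = n by lia.
by have -> : - (- t - 1) - 1 = t by lia.
Qed.

Lemma family_spatial_shift (k : int) x xs us : family_ok F x xs us ->
  family_ok F (fun n => x (n + k)) (fun n => xs (n + k)) (fun n => us (n + k)).
Proof.
move=> [ok ok0]; split=> [n t|n]; last exact: ok0.
by rewrite (_ : n - 1 + k = n + k - 1) ?ok//; lia.
Qed.

Lemma Xstar_spatial_shift (k : int) x :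
  Xstar F x -> Xstar F (fun n => x (n + k)).
Proof.
move=> [xs [us [ok U]]]; exists (fun n => xs (n + k)), (fun n => us (n + k)).
split; first exact: family_spatial_shift.
move=> xs' us' /(family_spatial_shift (- k)).
rewrite (_ : (fun n => _) = x); last by apply/funext => n; congr x; lia.
move=> /U [<- <-]; split; apply/funext => n; rewrite (_ : n + k - k = n)//; lia.
Qed.

Lemma family_time_shift (s : int) x xs us : family_ok F x xs us ->
  family_ok F (fun n => xs n s) (fun n t => xs n (t + s))
    (fun n t => us n (t + s)).
Proof.
move=> [ok _]; split=> [n t|n]; last by rewrite add0r.
by rewrite ok; congr (xs _ _, _); lia.
Qed.

Lemma Tmap_family x xs us : Xstar F x -> family_ok F x xs us ->
  Tmap F x = fun n => xs n 1.
Proof.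
move=> Sx ok; rewrite /Tmap.
have : exists o : option ((int -> int -> X0) * (int -> int -> U0)),
   match o with Some p => family_ok F x p.1 p.2 | None => False end.
  by exists (Some (xs, us)).
move=> /(ClassicalEpsilon.epsilon_spec (inhabits None)).
rewrite -/(family_of F x).
case: (family_of F x) => // p okp.
by have [->] := family_unique _ _ _ _ _ Sx okp ok.
Qed.

(** Uniqueness of the family through the row at time 0 does not by itself give uniqueness through a
    later row, so all forward iterates are required to lie in [Xstar]. *)
Definition survives x := forall s, Xstar F (iter s (Tmap F) x).

Lemma survives_Xstar x : survives x -> Xstar F x.
Proof. by move=> /(_ 0%N). Qed.

Lemma survives_iter s x : survives x -> survives (iter s (Tmap F) x).
Proof. by move=> Sx r; rewrite -iterD. Qed.

Lemma iter_Tmap_family s x xs us : survives x -> family_ok F x xs us ->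
  iter s (Tmap F) x = fun n => xs n s%:Z.
Proof.
move=> Sx ok; elim: s => [|s IH] /=.
  by apply/funext => n; case: ok => _ ->.
have ok' := family_time_shift s%:Z _ _ _ ok.
have := Sx s; rewrite IH => Ss.
rewrite (Tmap_family _ _ _ Ss ok').
by apply/funext => n; congr xs; lia.
Qed.

(** The unique family through the s-th iterate has the original row at time - s. *)
Lemma iter_Tmap_inj s x x' : survives x -> survives x' ->
  iter s (Tmap F) x = iter s (Tmap F) x' -> x = x'.
Proof.
move=> Sx Sx' e.
have [xs [us [ok _]]] := survives_Xstar _ Sx.
have [xs' [us' [ok' _]]] := survives_Xstar _ Sx'.
have := family_time_shift s%:Z _ _ _ ok'; have := family_time_shift s%:Z _ _ _ ok.
rewrite -!(iter_Tmap_family s _ _ _ _ ok)// -(iter_Tmap_family s _ _ _ _ ok')//.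
rewrite -e => ok1 ok2.
have [/(congr1 (fun f n => f n (- s%:Z))) xx _] :=
  family_unique _ _ _ _ _ (Sx s) ok1 ok2.
apply/funext => n; have := congr1 (@^~ n) xx.
by rewrite /= addNr; case: ok => _ ->; case: ok' => _ ->.
Qed.

(* at_most_one_dual_orbit reads column n+1 off column n of the u's. *)
Lemma dual_columns_determined (c : int) x x' xs us xs' us' :
  family_ok F x xs us -> family_ok F x' xs' us' ->
  (forall n : int, c <= n -> at_most_one_dual_orbit F (us n)) ->
  us c = us' c -> forall n, c < n -> x n = x' n.
Proof.
move=> [ok ok0] [ok' ok0'] one uc.
have step n : c <= n -> us n = us' n -> xs (n + 1) = xs' (n + 1).
  move=> cn un; apply: (one n cn) => t; rewrite /Fcheck /swap /=.
    by have := ok (n + 1) t; rewrite addrK => ->.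
  by have := ok' (n + 1) t; rewrite addrK -un => ->.
have all_u (k : nat) : us (c + k%:Z) = us' (c + k%:Z).
  elim: k => [|k IH]; first by rewrite addr0.
  have ck : c <= c + k%:Z by lia.
  have X := step _ ck IH.
  rewrite (_ : c + k.+1%:Z = c + k%:Z + 1); last by lia.
  apply/funext => t.
  have := ok (c + k%:Z + 1) t; have := ok' (c + k%:Z + 1) t.
  by rewrite addrK X IH => -> /(congr1 snd).
move=> n cn; rewrite -ok0 -ok0'.
have -> : n = (c + (absz (n - c - 1)%R)%:Z) + 1 by lia.
by rewrite (step _ _ (all_u _)) //; lia.
Qed.

End Families.

(** * Regularity of measures on sequence space *)

Section Probability.
Context {d : measure_display} {T : measurableType d} {R : realType}.
Variable P : probability T R.

Lemma le_prob (A B : set T) : measurable A -> measurable B -> A `<=` B ->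
  (P A <= P B)%E.
Proof. by move=> mA mB AB; apply: le_measure => //; rewrite inE. Qed.

Lemma prob_cover_le (A : set T) (F : nat -> set T) (e : R) : 0 <= e ->
  measurable A -> (forall n, measurable (F n)) -> A `<=` \bigcup_n F n ->
  (forall n, P (F n) <= (e / (2 ^ n.+1)%:R)%:E)%E -> (P A <= e%:E)%E.
Proof.
move=> e0 mA mF AF Fe.
apply: (le_trans (measure_sigma_subadditive P mF mA AF)).
apply: le_trans (epsilon_trick0 xpredT e0).
by apply: lee_nneseries => // n _; exact: Fe.
Qed.

Lemma prob_bigcup_lim (A : set T) (F : nat -> set T) (e : R) : 0 < e ->
  measurable A -> (forall n, measurable (F n)) -> A `<=` \bigcup_n F n ->
  exists N, (P (A `\` \big[setU/set0]_(i < N) F i) <= e%:E)%E.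
Proof.
move=> e0 mA mF AF.
pose G N := A `\` \big[setU/set0]_(i < N) F i.
have mG N : measurable (G N).
  by apply: measurableD => //; apply: bigsetU_measurable.
have G0 : \bigcap_n G n = set0.
  rewrite -subset0 => x Gx; have [Ax _] := Gx 0%N I.
  have [i _ Fi] := AF _ Ax; have [_] := Gx i.+1 I; apply.
  by rewrite big_ord_recr; right.
have : (P \o G) N @[N --> \oo] --> (0 : \bar R)%E.
  rewrite -(measure0 P) -G0; apply: nonincreasing_cvg_mu => //.
  - by apply: (le_lt_trans (probability_le1 P (mG 0%N))); rewrite ltry.
  - by rewrite G0.
  - move=> m n mn; apply/subsetPset => x [Ax nF]; split => //.
    by apply: contra_not nF; exact: (subset_bigsetU mn).
move=> /fine_cvgP [_ /cvgrPdist_le /(_ e e0) [N _ /(_ N (leqnn N))]] /=.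
rewrite sub0r normrN ger0_norm ?fine_ge0// => GN; exists N.
by rewrite -(@fineK _ (P (G N))) ?lee_fin// fin_num_measure.
Qed.

Lemma prob_full_setC (A : set T) : measurable A ->
  P A = 1%E <-> P (~` A) = 0%E.
Proof.
move=> mA; rewrite probability_setC//; split=> [->|]; first by rewrite subee.
rewrite -(@fineK _ (P A)) ?fin_num_measure// => -[] /eqP.
by rewrite subr_eq0 => /eqP <-.
Qed.

Lemma prob_full_bigcap (F : nat -> set T) : (forall n, measurable (F n)) ->
  (forall n, P (F n) = 1%E) -> P (\bigcap_n F n) = 1%E.
Proof.
move=> mF F1; apply/prob_full_setC; first exact: bigcapT_measurable.
apply/le_anti/andP; split; last exact: measure_ge0.
apply: (@prob_cover_le _ (fun n => ~` F n)) => //.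
- by apply: measurableC; exact: bigcapT_measurable.
- by move=> n; exact: measurableC.
- by rewrite setC_bigcap.
- by move=> n; have /(prob_full_setC _ (mF n)) -> := F1 n; rewrite mul0r.
Qed.

Lemma prob_full_setI (A B : set T) : measurable A -> measurable B ->
  P A = 1%E -> P B = 1%E -> P (A `&` B) = 1%E.
Proof.
move=> mA mB A1 B1; rewrite -bigcap2E; apply: prob_full_bigcap => -[|[|n]] //=;
  exact: probability_setT.
Qed.

Lemma prob_setI_full (A G : set T) : measurable A -> measurable G ->
  P G = 1%E -> P (A `&` G) = P A.
Proof.
move=> mA mG G1; apply/le_anti/andP; split.
  by apply: le_prob => //; apply: measurableI.
rewrite (measureDI P mA mG) [X in (X + _)%E](_ : _ = 0%E) ?add0e//.
apply: (@subset_measure0 _ _ _ _ _ (~` G)) => //.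
- exact: measurableD.
- exact: measurableC.
- exact/prob_full_setC.
Qed.

Lemma prob_full_nonempty (A : set T) : P A = 1%E -> exists x, A x.
Proof.
move=> A1; apply/not_existsP => A0; have : A = set0 by rewrite -subset0.
by move=> E; move: A1; rewrite E measure0 => -[] /eqP; rewrite eq_sym oner_eq0.
Qed.

End Probability.

Lemma filter_bigsetU {T : Type} (F : set_system T) (N : nat) (A : nat -> set T) :
  UltraFilter F -> F (\big[setU/set0]_(i < N) A i) -> exists i, F (A i).
Proof.
move=> UF; elim: N => [|N IH]; first by rewrite big_ord0 => /filter_not_empty.
rewrite big_ord_recr /= => FA.
have [FN|FN] := in_ultra_setVsetC (A N) UF; first by exists N.
by apply: IH; apply: filterS (filterI FA FN) => x [[]].
Qed.

(** * Inner regularity by closed sets *)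

Section Sequences.
Context {R : realType} {X : ptopologicalType}.
Hypothesis polX : polish R X.

Lemma open_borel (O : set X) : open O -> borel_sets O.
Proof. by move=> oO; apply: sub_sigma_algebra. Qed.

Lemma measurable_coord (n : int) (B : set X) : borel_sets B ->
  measurable ([set x | B (x n)] : set (seqZ X)).
Proof. by move=> mB; apply: sub_sigma_algebra; exists n, B. Qed.

Lemma measurable_coordC (n : int) (B : set X) : borel_sets B ->
  measurable ([set x | ~ B (x n)] : set (seqZ X)).
Proof. by move=> mB; apply: measurableC; exact: measurable_coord. Qed.

Definition coord_cvg (F : set_system (int -> X)) (x : int -> X) :=
  forall n (O : set X), open O -> O (x n) -> F [set y | O (y n)].

(* Closedness in the product topology, phrased through ultrafilters. *)
Definition ultra_closed (C : set (int -> X)) :=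
  forall F x, UltraFilter F -> coord_cvg F x -> F C -> C x.

Lemma ultra_closed_coordC (n : int) (O : set X) : open O ->
  ultra_closed [set x | ~ O (x n)].
Proof.
move=> oO F x UF Fx FC Oxn.
have [y []] := filter_ex (filterI (Fx n O oO Oxn) FC); exact.
Qed.

Lemma ultra_closedU C C' : ultra_closed C -> ultra_closed C' ->
  ultra_closed (C `|` C').
Proof.
move=> cC cC' F x UF Fx FU.
have [FC|FC] := in_ultra_setVsetC C UF; first by left; apply: (cC F).
right; apply: (cC' F) => //.
by apply: filterS (filterI FU FC) => y [[]].
Qed.

Lemma ultra_closed_bigsetU N (C : nat -> set (int -> X)) :
  (forall i, ultra_closed (C i)) -> ultra_closed (\big[setU/set0]_(i < N) C i).
Proof.
move=> cC; elim/big_ind: _ => //; last exact: ultra_closedU.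
by move=> F x UF _ /filter_not_empty.
Qed.

Lemma ultra_closed_bigcap (C : nat -> set (int -> X)) :
  (forall i, ultra_closed (C i)) -> ultra_closed (\bigcap_i C i).
Proof.
move=> cC F x UF Fx FC i _; apply: (cC i F) => //.
by apply: filterS FC => y /(_ i I).
Qed.

Section Regularity.
Variable P : probability (seqZ X) R.

Definition inner_closed (A : set (seqZ X)) := forall e : R, 0 < e ->
  exists C : set (seqZ X), [/\ ultra_closed C, measurable C, C `<=` A &
    (P (A `\` C) <= e%:E)%E].

(** Asking for approximation of the complement too makes the class stable under complements. *)
Definition regular (A : set (seqZ X)) :=
  [/\ measurable A, inner_closed A & inner_closed (~` A)].

Lemma inner_closed_self (A : set (seqZ X)) :
  ultra_closed A -> measurable A -> inner_closed A.
Proof.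
by move=> cA mA e e0; exists A; split=> //; rewrite setDv measure0 lee_fin ltW.
Qed.

(** Only finite unions of closed sets stay closed: half of [e] pays for approximating the [A i], the
    other half for truncating the union. *)
Lemma inner_closed_bigcup (A : nat -> set (seqZ X)) :
  (forall i, measurable (A i)) -> (forall i, inner_closed (A i)) ->
  inner_closed (\bigcup_i A i).
Proof.
move=> mA iA e e0.
have e2 : 0 < e / 2 by rewrite divr_gt0.
have /choice [C hC] i := iA i (e / 2 / (2 ^ i.+1)%:R)
  ltac:(by rewrite divr_gt0// ltr0n expn_gt0).
have mC i : measurable (C i) by have [] := hC i.
have mU : measurable (\bigcup_i C i) by apply: bigcupT_measurable.
have [N hN] := prob_bigcup_lim P _ _ _ e2 mU mC (@subset_refl _ _).
have mN : measurable (\big[setU/set0]_(i < N) C i) by apply: bigsetU_measurable.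
exists (\big[setU/set0]_(i < N) C i); split=> //.
- by apply: ultra_closed_bigsetU => i; have [] := hC i.
- move=> x; rewrite -bigcup_mkord => -[i _ Ci]; exists i => //.
  by have [_ _ + _] := hC i; apply.
- apply: (@le_trans _ _ (P ((\bigcup_i (A i `\` C i)) `|`
      (\bigcup_i C i `\` \big[setU/set0]_(i < N) C i)))).
    have mm : forall i, measurable (A i `\` C i) by move=> i; apply: measurableD.
    apply: le_prob.
    + by apply: measurableD => //; apply: bigcupT_measurable.
    + apply: measurableU; first exact: bigcupT_measurable.
      exact: measurableD.
    + move=> x [[i _ Ai] nN]; have [Ci|nC] := pselect ((\bigcup_i C i) x).
        by right.
      by left; exists i => //; split => // Ci; apply: nC; exists i.
  apply: (le_trans (measureU2 P _ _)).
  + by apply: bigcupT_measurable => i; apply: measurableD.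
  + exact: measurableD.
  rewrite [e]splitr EFinD; apply: leeD => //.
  apply: (@prob_cover_le _ _ _ _ _ (fun i => A i `\` C i)) => //.
  + exact: ltW.
  + by apply: bigcupT_measurable => i; apply: measurableD.
  + by move=> i; apply: measurableD.
  + by move=> i; have [] := hC i.
Qed.

Lemma inner_closed_bigcap (A : nat -> set (seqZ X)) :
  (forall i, measurable (A i)) -> (forall i, inner_closed (A i)) ->
  inner_closed (\bigcap_i A i).
Proof.
move=> mA iA e e0.
have /choice [C hC] i := iA i (e / (2 ^ i.+1)%:R)
  ltac:(by rewrite divr_gt0// ltr0n expn_gt0).
have mC i : measurable (C i) by have [] := hC i.
exists (\bigcap_i C i); split=> //.
- by apply: ultra_closed_bigcap => i; have [] := hC i.
- exact: bigcapT_measurable.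
- by move=> x Cx i _; have [_ _ + _] := hC i; apply; exact: Cx.
- apply: (@prob_cover_le _ _ _ _ _ (fun i => A i `\` C i)) => //.
  + exact: ltW.
  + by apply: measurableD; apply: bigcapT_measurable.
  + by move=> i; apply: measurableD.
  + move=> x [Ax]; rewrite -[~ _]/((~` _) x) setC_bigcap => -[i _ nC].
    by exists i => //; split=> //; exact: Ax.
  + by move=> i; have [] := hC i.
Qed.

Lemma sigma_algebra_regular : sigma_algebra setT regular.
Proof.
split.
- split=> //; apply: inner_closed_self => //.
  + by move=> F x UF _ /filter_not_empty.
  + by rewrite setC0.
  + exact: measurableC.
- move=> A [mA iA iA']; rewrite setTD; split=> //; first exact: measurableC.
  by rewrite setCK.
- move=> A rA; have mA i : measurable (A i) by have [] := rA i.
  split; first exact: bigcupT_measurable.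
    by apply: inner_closed_bigcup => // i; have [] := rA i.
  rewrite setC_bigcup; apply: inner_closed_bigcap => i.
    exact: measurableC.
  by have [] := rA i.
Qed.

Lemma regular_open (n : int) (O : set X) : open O ->
  regular [set x : seqZ X | O (x n)].
Proof.
have [D [D0 [D1 [Dsym [Dtri [Dopen _]]]]]] := polX.
move=> oO; split.
- by apply: measurable_coord; apply: open_borel.
(* [U i] is the open neighbourhood of radius 1/(i+1) of the complement of [O]; the closed
   complements of the [U i] exhaust [O]. *)
- pose U (i : nat) := \bigcup_(z in ~` O) [set y | D z y < i.+1%:R^-1].
  have oU i : open (U i).
    apply: bigcup_open => z _; apply/Dopen => y /= zy.
    exists (i.+1%:R^-1 - D z y); first by rewrite subr_gt0.
    by move=> w /= yw; apply: (le_lt_trans (Dtri z y w)); rewrite addrC -ltrBrDr.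
  rewrite (_ : [set x : seqZ X | O (x n)] =
               \bigcup_i [set x : seqZ X | ~ U i (x n)]).
    have mm i : measurable ([set x | ~ U i (x n)] : set (seqZ X)).
      by apply: measurable_coordC; apply: open_borel.
    by apply: inner_closed_bigcup => // i; apply: inner_closed_self => //;
       apply: ultra_closed_coordC.
  apply/seteqP; split=> x /=.
    move=> /((Dopen O).1 oO) [e e0 xe].
    have [N _ /(_ N (leqnn N)) Ne] := near_infty_natSinv_lt (PosNum e0).
    exists N => // -[z nOz /= zx]; apply: nOz; apply: xe => /=.
    by rewrite Dsym; apply: lt_trans zx Ne.
  move=> [i _ nU]; apply: contrapT => nO; apply: nU; exists (x n) => //=.
  by have /D1 -> := erefl (x n); rewrite invr_gt0.
- apply: inner_closed_self; first exact: ultra_closed_coordC.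
  by apply: measurable_coordC; apply: open_borel.
Qed.

(** Regular events form a sigma-algebra, so cylinders suffice; for a fixed coordinate the Borel
    bases of regular cylinders again form a sigma-algebra, so open bases suffice. *)
Lemma measurable_regular (A : set (seqZ X)) : measurable A -> regular A.
Proof.
apply: smallest_sub; first exact: sigma_algebra_regular.
move=> _ [n [B [mB ->]]]; move: B mB.
apply: smallest_sub; last exact: regular_open.
have [S0 SC SU] := sigma_algebra_regular; split.
- exact: S0.
- by move=> B /SC; rewrite !setTD.
- by move=> B /SU; rewrite -preimage_bigcup.
Qed.

End Regularity.
End Sequences.

(** * Ultrafilters and finite codes of events *)

Lemma ultra_of_decreasing {T : Type} (B : nat -> set T) :
  (forall k, B k !=set0) -> (forall k, B k.+1 `<=` B k) ->
  exists U : set_system T, UltraFilter U /\ forall k, U (B k).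
Proof.
move=> B0 BS.
have BD m n : (m <= n)%N -> B n `<=` B m.
  by move=> /subnK <-; elim: (n - m)%N => //= k IH;
    apply: subset_trans IH; exact: BS.
pose F0 : set_system T := [set S | exists k, B k `<=` S].
have PF : ProperFilter F0.
  split; first by move=> [k Bk]; have [x /Bk] := B0 k.
  split.
  - by exists 0%N.
  - move=> P Q [k Pk] [l Ql]; exists (maxn k l) => x Bx; split.
      by apply: Pk; apply: BD Bx; rewrite leq_maxl.
    by apply: Ql; apply: BD Bx; rewrite leq_maxr.
  - by move=> P Q PQ [k Pk]; exists k; apply: subset_trans PQ.
have [U [UU FU]] := ultraFilterLemma PF.
by exists U; split => // k; apply: FU; exists k.
Qed.

Lemma ultra_fmap {T U : Type} (f : T -> U) (F : set_system T) :
  UltraFilter F -> UltraFilter [set S | F (f @^-1` S)].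
Proof.
move=> UF; have PF : ProperFilter [set S | F (f @^-1` S)].
  split; first by move=> /filter_not_empty.
  split.
  - by rewrite /= preimage_setT; exact: filterT.
  - by move=> P Q /= FP FQ; rewrite preimage_setI; exact: filterI.
  - by move=> P Q PQ /=; apply: filterS => x; exact: PQ.
split => // G PG FG; apply/seteqP; split => // S GS.
have [//|FS] := in_ultra_setVsetC (f @^-1` S) UF.
have GC : G (~` S) by exact: FG.
by have [x []] := filter_ex (filterI GS GC).
Qed.

Section Codes.
Context {T : Type}.

(** A set [S] of codes stands for an arbitrary Boolean combination of the first k events, namely the
    set of [x] with [S (event_code D k x)]. *)
Definition event_code (D : nat -> set T) (k : nat) (x : T) : seq bool :=
  mkseq (fun j => `[< D j x >]) k.

Lemma event_codeP {U : Type} (D : nat -> set T) (D' : nat -> set U) k x y :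
  mkseq (fun j => `[< D j x >]) k = mkseq (fun j => `[< D' j y >]) k ->
  forall j, (j < k)%N -> (D j x <-> D' j y).
Proof.
move=> e j jk; move: (congr1 (nth true ^~ j) e).
rewrite !nth_mkseq// => ee.
by split => /asboolP; [rewrite ee|rewrite -ee] => /asboolP.
Qed.

End Codes.

Lemma measurable_event_code {d : measure_display} {T : measurableType d}
    (D : nat -> set T) k (S : set (seq bool)) :
  (forall j, measurable (D j)) -> measurable [set x | S (event_code D k x)].
Proof.
move=> mD; rewrite /event_code; elim: k S => [|k IH] S.
  have [S0|S0] := pselect (S [::]).
    by rewrite (_ : [set _ | _] = setT)//; apply/seteqP; split.
  by rewrite (_ : [set _ | _] = set0)//; apply/seteqP; split.
rewrite (_ : [set _ | _] =
  (D k `&` [set x | S (rcons (mkseq (fun j => `[< D j x >]) k) true)]) `|`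
  (~` D k `&` [set x | S (rcons (mkseq (fun j => `[< D j x >]) k) false)])).
  apply: measurableU; apply: measurableI => //.
  - exact: (IH [set s | S (rcons s true)]).
  - exact: measurableC.
  - exact: (IH [set s | S (rcons s false)]).
apply/seteqP; split => x /=; rewrite mkseqS.
- by case: asboolP => Dx Sx; [left|right].
- by case=> -[Dx]; case: asboolP.
Qed.

(** * Tightness, separation and measurable images *)

Section Compactness.
Context {R : realType} {X : ptopologicalType}.
Hypothesis polX : polish R X.

Lemma polish_dense_sequence (D : set X) (dist : X -> X -> R) :
  countable D ->
  (forall x (e : R), 0 < e -> exists2 y, D y & dist x y < e) ->
  exists q : nat -> X, forall x (e : R), 0 < e -> exists i, dist x (q i) < e.
Proof.
move=> /countable_injP [f finj] dD.
(* Indices outside the range of [f] yield a default point, possibly outside [D]; it does no harm, as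
   only density is claimed. *)
exists (fun i => get [set y | D y /\ f y = i]) => x e e0.
have [y Dy xy] := dD x e e0; exists (f y).
have [|Dz fz] := @getPex _ [set z | D z /\ f z = f y]; first by exists y.
by rewrite (finj _ _ (mem_set Dz) (mem_set Dy) fz).
Qed.

Lemma polish_separating : exists O : nat -> set X,
  (forall i, open (O i)) /\ forall x y, (forall i, O i x <-> O i y) -> x = y.
Proof.
have [D [D0 [D1 [Dsym [Dtri [Dopen [_ [E [cE dE]]]]]]]]] := polX.
have [q hq] := polish_dense_sequence _ _ cE dE.
(* Balls are enumerated through codes of pairs; a natural that encodes no pair falls back on (0, 0),
   which only repeats a ball. *)
pose idx j : nat * nat := odflt (0%N, 0%N) (unpickle j).
exists (fun j => [set y | D (q (idx j).1) y < (idx j).2.+1%:R^-1]); split.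
  move=> j; apply/Dopen => y /= zy.
  exists ((idx j).2.+1%:R^-1 - D (q (idx j).1) y); first by rewrite subr_gt0.
  move=> w /= yw; apply: (le_lt_trans (Dtri _ y w)).
  by rewrite addrC -ltrBrDr.
move=> x y xy; apply: contrapT => nxy.
have dxy : 0 < D x y.
  by rewrite lt_neqAle D0 andbT eq_sym; apply/eqP => /D1.
have d2 : 0 < D x y / 2 by rewrite divr_gt0.
have [N _ /(_ N (leqnn N)) Ne] := near_infty_natSinv_lt (PosNum d2).
have N0 : (0 : R) < N.+1%:R^-1 by rewrite invr_gt0.
have [i xi] := hq x _ N0.
have := (xy (pickle (i, N))).1; rewrite /= /idx pickleK /= Dsym => /(_ xi) yi.
have := Dtri x (q i) y; rewrite leNgt => /negP; apply.
by rewrite [ltRHS]splitr ltrD// (lt_trans _ Ne).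
Qed.

Variable P : probability (seqZ X) R.

(** For every coordinate n and scale k, finitely many closed balls of radius 1/(k+1) about a dense
    sequence capture that coordinate up to a small mass. [K] imposes all these constraints, and
    completeness makes every ultrafilter on it converge. *)
Lemma tight (e : R) : 0 < e -> exists K : set (seqZ X),
  [/\ measurable K, ultra_closed K, (P (~` K) <= e%:E)%E &
   forall F : set_system (int -> X), UltraFilter F -> F K ->
     exists x, coord_cvg F x].
Proof.
move=> e0.
have [D [D0 [D1 [Dsym [Dtri [Dopen [Dcomp [E [cE dE]]]]]]]]] := polX.
have [q hq] := polish_dense_sequence _ _ cE dE.
pose idx j : int * nat := odflt (0, 0%N) (unpickle j).
pose V j i : set X := [set y | (idx j).2.+1%:R^-1 < D (q i) y].
have oV j i : open (V j i).
  apply/Dopen => y /= zy.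
  exists (D (q i) y - (idx j).2.+1%:R^-1); first by rewrite subr_gt0.
  move=> w /= yw; have := Dtri (q i) w y; rewrite (Dsym w).
  move: yw; rewrite ltrBrDl -ltrBrDr => yw ?.
  by apply: (lt_le_trans yw); rewrite lerBlDr.
pose W j i : set (seqZ X) := [set x | ~ V j i (x (idx j).1)].
have mW j i : measurable (W j i).
  by apply: measurable_coordC; apply: open_borel.
have Wcov j : setT `<=` \bigcup_i W j i.
  move=> x _; have [|i qi] := hq (x (idx j).1) ((idx j).2.+1%:R^-1).
    by rewrite invr_gt0.
  by exists i => //; rewrite /W /V /= Dsym; apply/negP; rewrite -leNgt ltW.
have /choice [N hN] j := prob_bigcup_lim P _ _ (e / (2 ^ j.+1)%:R)
  ltac:(by rewrite divr_gt0// ltr0n expn_gt0) measurableT (mW j) (Wcov j).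
pose L j := \big[setU/set0]_(i < N j) W j i.
have mL j : measurable (L j) by apply: bigsetU_measurable.
exists (\bigcap_j L j); split.
- exact: bigcapT_measurable.
- apply: ultra_closed_bigcap => j; apply: ultra_closed_bigsetU => i.
  exact: ultra_closed_coordC.
- apply: (@prob_cover_le _ _ _ _ _ (fun j => ~` L j)).
  + exact: ltW.
  + by apply: measurableC; apply: bigcapT_measurable.
  + by move=> j; apply: measurableC.
  + by rewrite setC_bigcap.
  + by move=> j; rewrite -setTD; exact: hN.
- move=> F UF FK.
  suff /choice [x hx] : forall n : int, exists p : X, forall O : set X,
      open O -> O p -> F [set y | O (y n)] by exists x.
  move=> n.
  (* At each scale the ultrafilter selects one of the finitely many balls. *)
  have /choice [i hi] k : exists i, F [set y | D (q i) (y n) <= k.+1%:R^-1].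
    have /filter_bigsetU : F (L (pickle (n, k))).
      by apply: filterS FK => y /(_ (pickle (n, k)) I).
    move=> [i Fi]; exists i; apply: filterS Fi => y.
    rewrite /W /V /idx /= pickleK /= => /negP.
    by rewrite -leNgt.
  have small (r : R) : 0 < r -> exists M, forall k, (M <= k)%N -> k.+1%:R^-1 < r / 2.
    move=> r0; have r2 : 0 < r / 2 by rewrite divr_gt0.
    have [M _ hM] := near_infty_natSinv_lt (PosNum r2).
    by exists M => k; exact: hM.
  have [l hl] : exists l, forall r : R, 0 < r -> exists M, forall k, (M <= k)%N ->
      D (q (i k)) l < r.
    (* Any two selected balls meet, so their centres form a Cauchy sequence. *)
    apply: (Dcomp (fun k => q (i k))) => r /small [M hM]; exists M => k k' Mk Mk'.
    have [y [yk yk']] := filter_ex (filterI (hi k) (hi k')).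
    apply: (le_lt_trans (Dtri _ (y n) _)).
    rewrite [ltRHS]splitr (Dsym (y n)) ltrD//.
      exact: le_lt_trans yk (hM _ Mk).
    exact: le_lt_trans yk' (hM _ Mk').
  exists l => O oO Ol; have [r r0 rO] := (Dopen O).1 oO l Ol.
  have [M hM] := small r r0.
  have r2 : 0 < r / 2 by rewrite divr_gt0.
  have [M' hM'] := hl _ r2.
  have Mk := leq_maxl M M'; have Mk' := leq_maxr M M'.
  apply: filterS (hi (maxn M M')) => y /= yk; apply: rO => /=.
  apply: (le_lt_trans (Dtri _ (q (i (maxn M M'))) _)).
  rewrite [ltRHS]splitr (Dsym l) ltrD//; first exact: hM'.
  exact: le_lt_trans yk (hM _ Mk).
Qed.

(* A Lusin-type statement: K is compact and every D j is clopen in K. *)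
Lemma inner_compact (A : set (seqZ X)) (D : nat -> set (seqZ X)) (e : R) :
  measurable A -> (forall j, measurable (D j)) -> 0 < e ->
  exists K : set (seqZ X), [/\ measurable K, K `<=` A, (P (A `\` K) <= e%:E)%E &
    forall F : set_system (seqZ X), UltraFilter F -> F K ->
      exists2 x, K x & forall j, D j x <-> F (D j)].
Proof.
move=> mA mD e0.
have pos i : 0 < e / (2 ^ i.+1)%:R by rewrite divr_gt0// ltr0n expn_gt0.
have pos2 i : 0 < e / (2 ^ i.+1)%:R / 2 by rewrite divr_gt0.
have reg B : measurable B -> regular P B by apply: measurable_regular.
have [K0 [mK0 cK0 PK0 K0cvg]] := tight _ (pos 0%N).
have [_ iA _] := reg _ mA; have [C [cC mC CA PC]] := iA _ (pos 1%N).
have /choice [Y hY] (j : nat) : exists Y : set (seqZ X),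
    [/\ ultra_closed Y, measurable Y, Y `<=` D j &
    (P (D j `\` Y) <= (e / (2 ^ j.+3)%:R / 2)%:E)%E].
  by have [_ + _] := reg _ (mD j); apply.
have /choice [Z hZ] (j : nat) : exists Z : set (seqZ X),
    [/\ ultra_closed Z, measurable Z, Z `<=` ~` D j &
    (P (~` D j `\` Z) <= (e / (2 ^ j.+3)%:R / 2)%:E)%E].
  by have [_ _] := reg _ (mD j); apply.
have cY j : ultra_closed (Y j) by have [] := hY j.
have cZ j : ultra_closed (Z j) by have [] := hZ j.
have mY j : measurable (Y j) by have [] := hY j.
have mZ j : measurable (Z j) by have [] := hZ j.
have YD j : Y j `<=` D j by have [] := hY j.
have ZD j : Z j `<=` ~` D j by have [] := hZ j.
have mYZ : measurable (\bigcap_j (Y j `|` Z j)).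
  by apply: bigcapT_measurable => j; apply: measurableU.
have mK : measurable (K0 `&` C `&` \bigcap_j (Y j `|` Z j)).
  by apply: measurableI => //; apply: measurableI.
exists (K0 `&` C `&` \bigcap_j (Y j `|` Z j)); split => //.
- by move=> x [[_ /CA]].
(* Error budget: e/2 for leaving [K0], e/4 for [A] outside [C], and e/2^(j+3) for the j-th event,
   shared equally by [Y j] and [Z j]. *)
- pose B (i : nat) : set (seqZ X) := if i is i'.+1 then
    if i' is j.+1 then (D j `\` Y j) `|` (~` D j `\` Z j) else A `\` C
    else ~` K0.
  have mDY j : measurable (D j `\` Y j) by apply: measurableD.
  have mDZ j : measurable (~` D j `\` Z j).
    by apply: measurableD => //; apply: measurableC.
  have mB i : measurable (B i).
    case: i => [|[|j]]; [exact: measurableC|exact: measurableD|].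
    by apply: measurableU.
  apply: (@prob_cover_le _ _ _ P _ B e (ltW e0)) => //.
  + exact: measurableD.
  + move=> x [Ax nK]; apply: contrapT => nB; apply: nK; split; first split.
    * by apply: contrapT => nK0; apply: nB; exists 0%N.
    * by apply: contrapT => nC; apply: nB; exists 1%N.
    * move=> j _; apply: contrapT => nYZ; apply: nB; exists j.+2 => //=.
      have [Dx|Dx] := pselect (D j x); [left|right]; split=> // ?; apply: nYZ;
      by [left|right].
  + move=> [|[|j]] //=; apply: (le_trans (measureU2 P (mDY j) (mDZ j))).
    rewrite [e / _]splitr EFinD; apply: leeD; first by have [] := hY j.
    by have [] := hZ j.
- move=> F UF FK.
  have [x Fx] : exists x, coord_cvg F x.
    by apply: K0cvg; apply: filterS FK => x [[]].
  have FYZ j : F (Y j `|` Z j) by apply: filterS FK => y [_ /(_ j I)].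
  have xYZ j : (Y j `|` Z j) x.
    by apply: (@ultra_closedU X _ _ (cY j) (cZ j) F).
  exists x.
    split; last by move=> j _; exact: xYZ.
    by split; [apply: (cK0 F)|apply: (cC F)] => //; apply: filterS FK => y [[]].
  (* [F] contains the closed part [Y j] inside [D j] or the closed part [Z j] outside it, and the
     limit [x] stays in the same part. *)
  move=> j; split => [Dx|FD].
    have [//|FDC] := in_ultra_setVsetC (D j) UF.
    have : Z j x.
      apply: (cZ j F) => //; apply: filterS (filterI (FYZ j) FDC).
      by move=> y [[/YD|//]].
    by move=> /ZD.
  apply: YD; apply: (cY j F) => //; apply: filterS (filterI (FYZ j) FD).
  by move=> y [[//|/ZD]].
Qed.

Lemma prob_le_off_null (A B G : set (seqZ X)) : measurable A -> measurable B ->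
  measurable G -> P G = 1%E -> A `&` G `<=` B -> (P A <= P B)%E.
Proof.
move=> mA mB mG G1 AB; rewrite -(prob_setI_full P A G)//.
by apply: le_prob => //; apply: measurableI.
Qed.

(** A Blackwell-type statement: an event that the [D j] determine pointwise on a full set is a limit
    of finite Boolean combinations of them. [A] and its complement are replaced by compact [K] and
    [K'], which codes of one finite length separate. *)
Lemma separated_event_approx (A G : set (seqZ X)) (D : nat -> set (seqZ X))
    (e : R) :
  measurable A -> measurable G -> (forall j, measurable (D j)) -> P G = 1%E ->
  (forall x x', G x -> G x' -> (forall j, D j x <-> D j x') -> A x -> A x') ->
  0 < e -> exists k (S : set (seq bool)),
    (P (A `\` [set x | S (event_code D k x)]) <= e%:E)%E /\
    (P ([set x | S (event_code D k x)] `\` A) <= e%:E)%E.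
Proof.
move=> mA mG mD G1 sep e0.
have mAG : measurable (A `&` G) by apply: measurableI.
have mAG' : measurable (~` A `&` G).
  by apply: measurableI => //; apply: measurableC.
have [K [mK KA PK hK]] := inner_compact _ D _ mAG mD e0.
have [K' [mK' KA' PK' hK']] := inner_compact _ D _ mAG' mD e0.
have [k hk] : exists k, forall x x', K x -> K' x' ->
    event_code D k x <> event_code D k x'.
  apply: contrapT => no.
  (* If no length works, the pairs with equal codes of length k decrease and are nonempty; an
     ultrafilter on them has limits in [K] and [K'] that no [D j] tells apart. *)
  pose B k : set (seqZ X * seqZ X) :=
    [set p | [/\ K p.1, K' p.2 & event_code D k p.1 = event_code D k p.2]].
  have B0 k : B k !=set0.
    apply/set0P/negP => /eqP Bk; apply: no; exists k => x x' Kx Kx' e'.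
    by have : B k (x, x') by []; rewrite Bk.
  have BS k : B k.+1 `<=` B k.
    move=> [x x'] [/= Kx Kx']; rewrite /event_code !mkseqS => /rcons_inj [ee _].
    by split.
  have [U [UU UB]] := ultra_of_decreasing _ B0 BS.
  have [x Kx hx] : exists2 x, K x & forall j, D j x <-> U (fst @^-1` D j).
    apply: (hK _ (ultra_fmap fst _ UU)).
    by rewrite /=; apply: filterS (UB 0%N) => p -[].
  have [x' Kx' hx'] : exists2 x, K' x & forall j, D j x <-> U (snd @^-1` D j).
    apply: (hK' _ (ultra_fmap snd _ UU)).
    by rewrite /=; apply: filterS (UB 0%N) => p -[].
  have [Ax Gx] := KA _ Kx; have [nAx' Gx'] := KA' _ Kx'.
  apply: nAx'; apply: sep Ax => // j; rewrite hx hx'.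
  split => Uj; apply: filterS (filterI (UB j.+1) Uj) => p [[_ _ c] Dp].
    exact: (event_codeP _ _ _ _ _ c j (ltnSn j)).1.
  exact: (event_codeP _ _ _ _ _ c j (ltnSn j)).2.
(* The codes realised on [K]: the resulting event contains [K] and misses [K']. *)
exists k, [set s | exists2 z, K z & s = event_code D k z].
have mB : measurable
    [set x : seqZ X | exists2 z, K z & event_code D k x = event_code D k z].
  exact: (measurable_event_code D k
    [set s | exists2 z, K z & s = event_code D k z]).
split.
- apply: le_trans PK; apply: (prob_le_off_null _ _ G) => //;
    try exact: measurableD.
  by move=> x [[Ax nB] Gx]; split => // Kx; apply: nB; exists x.
- apply: le_trans PK'; apply: (prob_le_off_null _ _ G) => //;
    try exact: measurableD.
  by move=> x [[[z Kz xz] nA] Gx]; split => // Kx; apply: (hk _ _ Kz Kx).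
Qed.

(** The image of [A] is not known to be measurable, but the images of suitable compact subsets are,
    and these subsets exhaust [A] up to a null set. *)
Lemma measurable_image_inner (A : set (seqZ X)) (h : seqZ X -> seqZ X) :
  measurable A -> measurable_fun A h ->
  exists M : set (seqZ X), [/\ measurable M, M `<=` h @` A &
    P (A `\` h @^-1` M) = 0%E].
Proof.
move=> mA mh; have [ B [oB sepB]] := polish_separating.
pose idx j : int * nat := odflt (0, 0%N) (unpickle j).
pose D' j : set (seqZ X) := [set z | B (idx j).2 (z (idx j).1)].
have mD' j : measurable (D' j) by apply: measurable_coord; apply: open_borel.
(* [h] is measurable on [A] only, hence the intersection with [A]. *)
pose D j : set (seqZ X) := A `&` h @^-1` D' j.
have mD j : measurable (D j) by exact: mh.
have sep x z : A x -> (forall j, D j x <-> D' j z) -> h x = z.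
  move=> Ax xz; apply/funext => n; apply: sepB => i.
  have := xz (pickle (n, i)).
  by rewrite /D /D' /idx pickleK /= => <-; split => [|[]].
have /choice [K hK] l := inner_compact A D l.+1%:R^-1 mA mD
  ltac:(by rewrite invr_gt0).
(* The points all of whose finite codes occur on [K l]; by compactness these are exactly the images
   of points of [K l]. *)
pose M l : set (seqZ X) := \bigcap_k
  [set z | [set s | exists2 x, K l x & s = event_code D k x] (event_code D' k z)].
have mM l : measurable (M l).
  apply: bigcapT_measurable => k.
  exact: (measurable_event_code D' k
    [set s | exists2 x, K l x & s = event_code D k x]).
have MK l z : M l z -> exists2 x, K l x & h x = z.
  move=> Mz; have [mK KA _ cK] := hK l.
  pose Bk k : set (seqZ X) :=
    [set x | K l x /\ event_code D' k z = event_code D k x].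
  have B0 k : Bk k !=set0 by have [x Kx ee] := Mz k I; exists x.
  have BS k : Bk k.+1 `<=` Bk k.
    by move=> x [Kx]; rewrite /event_code !mkseqS => /rcons_inj [ee _].
  have [U [UU UB]] := ultra_of_decreasing _ B0 BS.
  have [|x Kx hx] := cK U UU; first by apply: filterS (UB 0%N) => x [].
  exists x => //; apply: sep => [|j]; first exact: KA.
  rewrite hx; split => [Uj|Dz].
    have [y [[_ c] Dy]] := filter_ex (filterI (UB j.+1) Uj).
    exact: (event_codeP _ _ _ _ _ c j (ltnSn j)).2.
  apply: filterS (UB j.+1) => y [_ c].
  exact: (event_codeP _ _ _ _ _ c j (ltnSn j)).1.
have KM l x : K l x -> M l (h x).
  move=> Kx k _; exists x => //; have [_ KA _ _] := hK l.
  apply: eq_map => j; apply: asbool_equiv_eq; split; last by case.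
  by move=> Dx; split => //; exact: KA.
have mMU : measurable (\bigcup_l M l) by exact: bigcupT_measurable.
have mN : measurable (A `\` h @^-1` (\bigcup_l M l)).
  rewrite (_ : _ `\` _ = A `\` (A `&` h @^-1` (\bigcup_l M l))).
    by apply: measurableD => //; apply: mh.
  apply/seteqP; split => x [Ax nx]; split => //; first by move=> [].
  by move=> Mx; apply: nx.
exists (\bigcup_l M l); split => //.
  move=> z [l _ /MK [x Kx <-]]; exists x => //.
  by have [_ KA _ _] := hK l; apply: KA.
apply/le_anti/andP; split; last exact: measure_ge0.
apply/lee_addgt0Pr => e e0; rewrite add0e.
have [l _ /(_ l (leqnn l)) le'] := near_infty_natSinv_lt (PosNum e0).
have [mK KA PK _] := hK l.
apply: (@le_trans _ _ (l.+1%:R^-1)%:E); last by rewrite lee_fin ltW.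
apply: le_trans PK; apply: le_prob => //; first exact: measurableD.
by move=> x [Ax nx]; split => // Kx; apply: nx; exists l => //; exact: KM.
Qed.

End Compactness.

(** * Product measures *)

Section Mixing.
Context {R : realType} {X : ptopologicalType}.

Definition box (s : seq int) (A : int -> set X) : set (seqZ X) :=
  [set x | forall n, n \in s -> A n (x n)].

Lemma measurable_box s A : (forall n, borel_sets (A n)) -> measurable (box s A).
Proof.
move=> mA; elim: s => [|k s IH].
  by rewrite (_ : box _ _ = setT)//; apply/seteqP; split.
rewrite (_ : box _ _ = [set x | A k (x k)] `&` box s A).
  by apply: measurableI => //; apply: measurable_coord.
apply/seteqP; split => x /=.
  move=> h; split; first by apply: h; rewrite inE eqxx.
  by move=> n ns; apply: h; rewrite inE ns orbT.
by move=> [Ak As] n; rewrite inE => /predU1P[->//|/As].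
Qed.

Definition boxes : set (set (seqZ X)) :=
  [set E | exists s A, [/\ uniq s, forall n, borel_sets (A n) & E = box s A]].

Lemma borel_setT : borel_sets (setT : set X).
Proof. by apply: open_borel; exact: openT. Qed.

Lemma borel_setI (A B : set X) : borel_sets A -> borel_sets B ->
  borel_sets (A `&` B).
Proof. by move=> mA mB; exact: (@measurableI _ (borelT X)). Qed.

Lemma boxes_setI : setI_closed boxes.
Proof.
move=> _ _ [s [A [us mA ->]]] [s' [A' [us' mA' ->]]].
exists (undup (s ++ s')), (fun n => (if n \in s then A n else setT) `&`
   (if n \in s' then A' n else setT)); split.
- exact: undup_uniq.
- by move=> n; apply: borel_setI; case: ifP => // _; exact: borel_setT.
- apply/seteqP; split => x /=.
    by move=> [h h'] n _; split; case: ifP => // ns; [exact: h|exact: h'].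
  move=> h; split => n ns; have := h n;
    rewrite mem_undup mem_cat ns ?orbT => /(_ isT) /=.
    by case.
  by case.
Qed.

Lemma boxes_generate : (measurable : set (set (seqZ X))) = <<s boxes >>.
Proof.
apply/seteqP; split.
  apply: smallest_sub; first exact: smallest_sigma_algebra.
  move=> _ [n [B [mB ->]]]; apply: sub_sigma_algebra.
  exists [:: n], (fun=> B); split => //; apply/seteqP; split => x /=.
    by move=> Bx k; rewrite inE => /eqP ->.
  by apply; rewrite inE.
apply: smallest_sub; first exact: sigma_algebra_measurable.
by move=> _ [s [A [_ mA ->]]]; exact: measurable_box.
Qed.

Lemma measurable_fun_seqZ {d} {T : measurableType d} (f : T -> seqZ X)
    (D : set T) : measurable D ->
  (forall n B, borel_sets B -> measurable (D `&` [set x | B (f x n)])) ->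
  measurable_fun D f.
Proof.
move=> mD h; apply: (@measurability _ _ T (seqZ X) D f (@cylinders X)) => //.
by move=> _ [_ [n [B [mB ->]]] <-]; exact: h.
Qed.

Variables (mu : probability (borelT X) R) (P : probability (seqZ X) R).
Hypothesis Pprod : is_product_measure mu P.

Lemma product_box s A : uniq s -> (forall n, borel_sets (A n)) ->
  P (box s A) = (\prod_(n <- s) mu (A n))%E.
Proof. exact: Pprod. Qed.

Lemma product_law_unique {d} {T : measurableType d}
    (m : {measure set T -> \bar R}) (f : T -> seqZ X) :
  measurable_fun setT f ->
  (forall s A, uniq s -> (forall n, borel_sets (A n)) ->
    m (f @^-1` box s A) = (\prod_(n <- s) mu (A n))%E) ->
  forall E, measurable E -> m (f @^-1` E) = P E.
Proof.
move=> mf h E mE.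
have hP : forall E, boxes E -> P E = pushforward m f E.
  by move=> _ [s [A [us mA ->]]]; rewrite /pushforward h// product_box.
symmetry.
apply: (measure_unique boxes (fun=> setT) boxes_generate boxes_setI _ _ _
  (pushforward m f) hP _ E mE) => //.
- by move=> _; exists [::], (fun=> setT); split => // [_|]; [exact: borel_setT|
    apply/seteqP; split].
- by apply/seteqP; split => // x _; exists 0%N.
- by move=> _; apply: (le_lt_trans (probability_le1 P measurableT)); rewrite ltry.
Qed.

Definition spatial_shift (k : int) (x : seqZ X) : seqZ X := fun n => x (n + k).

Lemma measurable_spatial_shift k : measurable_fun setT (spatial_shift k).
Proof.
apply: measurable_fun_seqZ => // n B mB; rewrite setTI.
exact: (measurable_coord (n + k)).
Qed.

Lemma spatial_shift_law k (E : set (seqZ X)) : measurable E ->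
  P (spatial_shift k @^-1` E) = P E.
Proof.
apply: product_law_unique; first exact: measurable_spatial_shift.
move=> s A us mA; rewrite (_ : _ @^-1` _ =
  box (map (+%R^~ k) s) (fun n => A (n - k))).
  rewrite [LHS]product_box ?map_inj_uniq//; last exact: addIr.
  by rewrite big_map; apply: eq_bigr => n _; rewrite addrK.
apply/seteqP; split => x /= h n.
  by move=> /mapP[j js ->]; rewrite addrK; exact: h.
by move=> ns; have := h (n + k); rewrite addrK; apply; apply/mapP; exists n.
Qed.

Definition mix (w : pred int) (a b : seqZ X) : seqZ X :=
  fun n => if w n then a n else b n.

Lemma measurable_mix w : measurable_fun setT
  (fun p : seqZ X * seqZ X => mix w p.1 p.2).
Proof.
apply: measurable_fun_seqZ => // n B mB; rewrite setTI /mix.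
case: (w n); rewrite -[X in measurable X]setTI.
  exact: (@measurable_fst _ _ (seqZ X) (seqZ X) measurableT _
    (measurable_coord n _ mB)).
exact: (@measurable_snd _ _ (seqZ X) (seqZ X) measurableT _
  (measurable_coord n _ mB)).
Qed.

Lemma measurable_mixl w b : measurable_fun setT (mix w ^~ b).
Proof.
apply: measurable_fun_seqZ => // n B mB; rewrite setTI /mix.
case: (w n); first exact: measurable_coord.
have [Bb|Bb] := pselect (B (b n)).
  by rewrite (_ : [set _ | _] = setT)//; apply/seteqP; split.
by rewrite (_ : [set _ | _] = set0)//; apply/seteqP; split.
Qed.

Lemma mixC w a b : mix (predC w) b a = mix w a b.
Proof. by apply/funext => n; rewrite /mix /=; case: (w n). Qed.

Lemma measurable_mixr w a : measurable_fun setT (mix w a).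
Proof.
rewrite (_ : mix w a = mix (predC w) ^~ a); first exact: measurable_mixl.
by apply/funext => b; rewrite mixC.
Qed.

(** Splicing two independent samples along [w] has law [P] again, because the product over a box
    splits into the sites in [w] and the others. *)
Lemma mix_law w (E : set (seqZ X)) : measurable E ->
  (P \x P)%E ((fun p => mix w p.1 p.2) @^-1` E) = P E.
Proof.
apply: product_law_unique; first exact: measurable_mix.
move=> s A us mA; rewrite (_ : _ @^-1` _ =
  box (seq.filter w s) A `*` box (seq.filter (predC w) s) A).
  transitivity (P (box (seq.filter w s) A) * P (box (seq.filter (predC w) s) A))%E.
    by apply: product_measure1E; exact: measurable_box.
  rewrite !product_box ?filter_uniq// !big_filter.
  by rewrite [RHS](bigID w).
apply/seteqP; split => -[a b] /=; rewrite /mix /=.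
  move=> h; split => n; rewrite mem_filter => /andP[wn ns]; have := h n ns.
    by rewrite wn.
  by rewrite (negbTE wn).
move=> [h h'] n ns; case: ifPn => wn.
  by apply: h; rewrite mem_filter wn.
by apply: h'; rewrite mem_filter /= wn.
Qed.

(** After splicing two independent samples, [E] depends on the first one only and [E'] on the second
    one only. *)
Lemma mix_indep (w : pred int) (E E' : set (seqZ X)) :
  measurable E -> measurable E' ->
  (forall x y : seqZ X, (forall n, w n -> x n = y n) -> E x -> E y) ->
  (forall x y : seqZ X, (forall n, ~~ w n -> x n = y n) -> E' x -> E' y) ->
  P (E `&` E') = (P E * P E')%E.
Proof.
move=> mE mE' hE hE'; rewrite -(mix_law w); last exact: measurableI.
transitivity ((P \x P)%E (E `*` E')); last exact: product_measure1E.
congr (product_measure1 _ _ _); apply/seteqP; split => -[a b] /= [Ea Eb]; split.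
- by apply: hE Ea => n; rewrite /mix => ->.
- by apply: hE' Eb => n; rewrite /mix => /negbTE ->.
- by apply: hE Ea => n; rewrite /mix => ->.
- by apply: hE' Eb => n; rewrite /mix => /negbTE ->.
Qed.

(** By Fubini almost every section of a full event is full; this allows one half of the line to be
    frozen. *)
Lemma mix_full_right w (E : set (seqZ X)) : measurable E -> P E = 1%E ->
  exists a, P (mix w a @^-1` E) = 1%E.
Proof.
move=> mE E1.
have mN : measurable ((fun p : seqZ X * seqZ X => mix w p.1 p.2) @^-1` (~` E)).
  by rewrite -[X in measurable X]setTI; apply: measurable_mix => //;
     exact: measurableC.
have N0 : (P \x P)%E ((fun p => mix w p.1 p.2) @^-1` (~` E)) = 0%E.
  by rewrite mix_law ?(prob_full_setC P _ mE).1//; exact: measurableC.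
have mf := measurable_fun_xsection P mN.
have : (\int[P]_(a in setT) `|(P \o xsection
    ((fun p : seqZ X * seqZ X => mix w p.1 p.2) @^-1` (~` E))) a| = 0)%E.
  rewrite -[RHS]N0 /product_measure1; apply: eq_integral => a _.
  by rewrite gee0_abs.
move=> /(ae_eq_integral_abs P measurableT mf).1 [N [mN' PN hN]].
have [a Na] : exists a, (~` N) a.
  apply: (prob_full_nonempty P); apply/(prob_full_setC P) => //.
    exact: measurableC.
  by rewrite setCK.
exists a.
have mEa : measurable (mix w a @^-1` E).
  by rewrite -[X in measurable X]setTI; exact: measurable_mixr.
apply/(prob_full_setC P) => //.
have : ~ ~ (P \o xsection
    ((fun p : seqZ X * seqZ X => mix w p.1 p.2) @^-1` (~` E))) a = 0%E.
  by move=> h; apply: Na; apply: hN => /= h'; apply: h; exact: h'.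
move=> /contrapT /= <-; congr (P _).
by apply/seteqP; split => b /=; rewrite /xsection /= inE.
Qed.

Lemma mix_full_left w (E : set (seqZ X)) : measurable E -> P E = 1%E ->
  exists b, P (mix w ^~ b @^-1` E) = 1%E.
Proof.
move=> mE /(mix_full_right (predC w) _ mE) [b hb]; exists b.
by rewrite -[RHS]hb; congr (P _); apply/seteqP; split => a /=; rewrite mixC.
Qed.

End Mixing.

(** * Past and future of a column *)

Section Dynamics.
Context {R : realType} {X0 : ptopologicalType} {U0 : topologicalType}.
Variable F : X0 * U0 -> X0 * U0.
Hypothesis polX : polish R X0.
Hypothesis Finv : forall p, F (F p) = p.
Variables (mu : probability (borelT X0) R) (P : probability (seqZ X0) R).
Hypothesis Pprod : is_product_measure mu P.
Hypothesis Xstar_meas : measurable (Xstar F : set (seqZ X0)).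
Hypothesis Xstar_full : P (Xstar F) = 1%E.
Hypothesis T_meas : measurable_fun (Xstar F : set (seqZ X0))
  (Tmap F : seqZ X0 -> seqZ X0).
Hypothesis T_inv : forall A : set (seqZ X0), measurable A ->
  P (Xstar F `&` Tmap F @^-1` A) = P A.

Notation Tm := (Tmap F : seqZ X0 -> seqZ X0).
Notation Tn s := (iter s Tm).

Let surv : set (seqZ X0) := [set x | survives F x].

(** The preimage is taken one step at a time inside [Xstar], where measurability and invariance of T
    are given. *)
Fixpoint iter_preimage (s : nat) (E : set (seqZ X0)) : set (seqZ X0) :=
  if s is r.+1 then Xstar F `&` Tm @^-1` iter_preimage r E else Xstar F `&` E.

Lemma iter_preimage_measurable s E : measurable E ->
  measurable (iter_preimage s E).
Proof.
move=> mE; elim: s => [|s IH] /=; first exact: measurableI.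
exact: T_meas.
Qed.

Lemma iter_preimage_prob s E : measurable E -> P (iter_preimage s E) = P E.
Proof.
move=> mE; elim: s => [|s IH] /=; first by rewrite setIC prob_setI_full.
by rewrite T_inv//; exact: iter_preimage_measurable.
Qed.

Lemma iter_preimageP s E x : iter_preimage s E x <->
  (forall r, (r <= s)%N -> Xstar F (Tn r x)) /\ E (Tn s x).
Proof.
elim: s x => [|s IH] x /=.
  split => [[Sx Ex]|[/(_ 0%N isT)]] //; split => // r.
  by rewrite leqn0 => /eqP ->.
split => [[Sx /IH[h]]|[h Ex]].
  by rewrite -iterSr => Ex; split => // -[|r] // rs; rewrite iterSr; exact: h.
split; first exact: (h 0%N).
by apply/IH; rewrite -iterSr; split => // r rs; rewrite -iterSr; exact: h.
Qed.

Lemma survE : surv = \bigcap_s iter_preimage s setT.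
Proof.
apply/seteqP; split => x.
  by move=> h s _; apply/iter_preimageP; split => // r _; exact: h.
by move=> h s; have /iter_preimageP [/(_ s (leqnn s))] := h s I.
Qed.

Lemma surv_measurable : measurable surv.
Proof.
by rewrite survE; apply: bigcapT_measurable => s; exact: iter_preimage_measurable.
Qed.

Lemma surv_full : P surv = 1%E.
Proof.
rewrite survE; apply: prob_full_bigcap => s; first exact: iter_preimage_measurable.
by rewrite iter_preimage_prob// probability_setT.
Qed.

Lemma surv_preimageE s E : surv `&` Tn s @^-1` E = iter_preimage s E `&` surv.
Proof.
apply/seteqP; split => x.
  by move=> [Sx Ex]; split => //; apply/iter_preimageP; split => // r _; exact: Sx.
by move=> [/iter_preimageP[_ Ex] Sx].
Qed.

Lemma surv_preimage_measurable s E : measurable E ->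
  measurable (surv `&` Tn s @^-1` E).
Proof.
move=> mE; rewrite surv_preimageE; apply: measurableI.
  exact: iter_preimage_measurable.
exact: surv_measurable.
Qed.

Lemma surv_preimage_prob s E : measurable E -> P (surv `&` Tn s @^-1` E) = P E.
Proof.
move=> mE; rewrite surv_preimageE prob_setI_full ?iter_preimage_prob//.
- exact: iter_preimage_measurable.
- exact: surv_measurable.
- exact: surv_full.
Qed.

(** * Resetting the right of a cut and reading off the past *)

Section Cut.
Variable c : int.
Let left_of : pred int := fun n => n <= c.
Let right_of (n : int) := c < n.

Lemma left_determines_future x x' s : survives F x -> survives F x' ->
  (forall n, left_of n -> x n = x' n) ->
  forall n, left_of n -> Tn s x n = Tn s x' n.
Proof.
move=> Sx Sx' xx' n nc.
have [xs [us [ok _]]] := survives_Xstar _ _ Sx.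
have [xs' [us' [ok' _]]] := survives_Xstar _ _ Sx'.
rewrite (iter_Tmap_family _ s _ _ _ Sx ok) (iter_Tmap_family _ s _ _ _ Sx' ok').
by have [] := upper_left_determined _ c _ _ _ _ _ _ (survives_Xstar _ _ Sx)
  ok ok' xx' n s%:Z nc isT.
Qed.

Variable b0 : seqZ X0.
Let reset (x : seqZ X0) : seqZ X0 := mix left_of x b0.
Hypothesis reset_full : P (reset @^-1` surv) = 1%E.

(* Replacing the right half of x by b0 and moving one step, the row to the right
   of the cut depends on x only through u_c^0, and determines it; unlike u_c^0,
   it is a measurable function of x. *)
Let theta (x : seqZ X0) : seqZ X0 := Tm (reset x).

Lemma reset_left x y : (forall n, left_of n -> x n = y n) -> reset x = reset y.
Proof.
move=> xy; apply/funext => n; rewrite /reset /mix.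
by case: ifP => // /xy.
Qed.

(** u_c^0 is the same for [x] and [reset x], which agree left of the cut. In the family of [reset x]
    shifted by one it becomes the value at time -1, determined by the right half of the new row,
    that is, by [theta x]. *)
Lemma theta_determines_u x x' xs us xs' us' :
  Xstar F x -> Xstar F x' -> family_ok F x xs us -> family_ok F x' xs' us' ->
  survives F (reset x) -> survives F (reset x') ->
  (forall n, right_of n -> theta x n = theta x' n) -> us c 0 = us' c 0.
Proof.
move=> Sx Sx' ok ok' Srx Srx' tt.
have rl y n : left_of n -> y n = reset y n by rewrite /reset /mix => ->.
have [ys [vs [okr _]]] := survives_Xstar _ _ Srx.
have [ys' [vs' [okr' _]]] := survives_Xstar _ _ Srx'.
have [_ ->] := upper_left_determined _ c _ _ _ _ _ _ Sx ok okr (rl x) c 0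
  (lexx c) isT.
have [_ ->] := upper_left_determined _ c _ _ _ _ _ _ Sx' ok' okr' (rl x') c 0
  (lexx c) isT.
have := family_time_shift _ 1 _ _ _ okr; have := family_time_shift _ 1 _ _ _ okr'.
rewrite -(Tmap_family _ _ _ _ (survives_Xstar _ _ Srx) okr).
rewrite -(Tmap_family _ _ _ _ (survives_Xstar _ _ Srx') okr') => ok2 ok1.
have := lower_right_determined _ Finv c _ _ _ _ _ _ (Srx 1%N) ok1 ok2 tt c (-1)
  (lexx c) isT.
by rewrite addNr.
Qed.

(** A full set stable under both T and [reset], on which [theta] makes sense at every later time. *)
Let good : set (seqZ X0) :=
  \bigcap_s (surv `&` Tn s @^-1` (reset @^-1` surv)).

Lemma reset_preimage_measurable E : measurable E -> measurable (reset @^-1` E).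
Proof.
by move=> mE; rewrite -[X in measurable X]setTI; exact: measurable_mixl.
Qed.

Lemma good_measurable : measurable good.
Proof.
apply: bigcapT_measurable => s; apply: surv_preimage_measurable.
by apply: reset_preimage_measurable; exact: surv_measurable.
Qed.

Lemma good_full : P good = 1%E.
Proof.
have mS := reset_preimage_measurable _ surv_measurable.
apply: prob_full_bigcap => s; first exact: surv_preimage_measurable.
by rewrite surv_preimage_prob.
Qed.

Lemma good_surv x : good x -> survives F x.
Proof. by move=> /(_ 0%N I) []. Qed.

Lemma good_reset_surv s x : good x -> survives F (reset (Tn s x)).
Proof. by move=> /(_ s I) []. Qed.

Lemma good_iter s x : good x -> good (Tn s x).
Proof.
move=> gx r _; split; first exact: survives_iter (good_surv _ gx).
by rewrite /= -iterD; exact: good_reset_surv.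
Qed.

(** The left half evolves without seeing the right half, so an initial reset is invisible after a
    later one. *)
Lemma iter_reset s x : good x -> reset (Tn s (reset x)) = reset (Tn s x).
Proof.
move=> gx; apply: reset_left => n nc; apply: left_determines_future => //.
- exact: (good_reset_surv 0 x gx).
- exact: good_surv.
- by move=> k kc; rewrite /reset /mix kc.
Qed.

Lemma good_reset x : good x -> good (reset x).
Proof.
move=> gx s _; split; first exact: (good_reset_surv 0 x gx).
by rewrite /= iter_reset//; exact: (good_reset_surv s x gx).
Qed.

Lemma theta_event_measurable n B : borel_sets B ->
  measurable (good `&` [set x | B (theta x n)]).
Proof.
move=> mB.
rewrite (_ : _ `&` _ = good `&` reset @^-1` (iter_preimage 1 [set z | B (z n)])).
  apply: measurableI; first exact: good_measurable.
  apply: reset_preimage_measurable; apply: iter_preimage_measurable.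
  exact: measurable_coord.
apply/seteqP; split => x [gx].
  move=> Bx; split => //; apply/iter_preimageP; split => // r _.
  exact: (good_reset_surv 0 x gx).
by move=> /iter_preimageP [_ Bx].
Qed.

(** [D.1] expresses an event of [theta] taken m steps earlier as an event of the present row z, for
    z in the full set [D.2]. Images under T^m are not known to be measurable, so measurable parts of
    the images for [B] and for its complement are used. *)
Lemma past_event (m : nat) (n : int) (B : set X0) : borel_sets B ->
  exists D : set (seqZ X0) * set (seqZ X0),
    [/\ measurable D.1, measurable D.2, P D.2 = 1%E & forall z, D.2 z ->
      exists x, [/\ good x, Tn m x = z & D.1 z <-> B (theta x n)]].
Proof.
move=> mB.
have mBC : borel_sets (~` B) by exact: (@measurableC _ (borelT X0)).
pose A1 := good `&` [set x | B (theta x n)].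
pose A2 := good `&` [set x | (~` B) (theta x n)].
have mA1 : measurable A1 := theta_event_measurable n _ mB.
have mA2 : measurable A2 := theta_event_measurable n _ mBC.
have mT A : measurable A -> A `<=` good -> measurable_fun A (Tn m).
  move=> mA Ag _ E mE.
  rewrite (_ : _ `&` _ = A `&` (surv `&` Tn m @^-1` E)).
    by apply: measurableI => //; exact: surv_preimage_measurable.
  apply/seteqP; split => x; first by move=> [Ax Ex]; split => //; split => //;
    exact: good_surv (Ag _ Ax).
  by move=> [Ax [_ Ex]].
have A1g : A1 `<=` good by move=> x [].
have A2g : A2 `<=` good by move=> x [].
have [M1 [mM1 M1A N1]] := measurable_image_inner polX P _ _ mA1 (mT _ mA1 A1g).
have [M2 [mM2 M2A N2]] := measurable_image_inner polX P _ _ mA2 (mT _ mA2 A2g).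
have mM := measurableU _ _ mM1 mM2.
exists (M1, M1 `|` M2); split => //=.
- rewrite -(surv_preimage_prob m)//.
  have mS := surv_preimage_measurable m _ mM.
  apply/prob_full_setC => //.
  have mD A M : measurable A -> measurable M -> A `<=` good ->
      measurable (A `\` Tn m @^-1` M).
    move=> mA mM' Ag.
    rewrite (_ : _ `\` _ = A `\` (A `&` Tn m @^-1` M)).
      by apply: measurableD => //; exact: mT.
    by apply/seteqP; split => x [Ax nx]; split => //; [case|move=> Mx; apply: nx].
  have eq_le0 (y : \bar R) : y = 0%E -> (y <= 0)%E by move=> ->.
  have mD1 := mD _ _ mA1 mM1 A1g; have mD2 := mD _ _ mA2 mM2 A2g.
  apply/le_anti/andP; split; last exact: measure_ge0.
  apply: (@le_trans _ _ (P ((A1 `\` Tn m @^-1` M1) `|` (A2 `\` Tn m @^-1` M2)))).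
    apply: (prob_le_off_null P _ _ good) => //.
    + exact: measurableC.
    + exact: measurableU.
    + exact: good_measurable.
    + exact: good_full.
    + move=> x [nS gx]; have Sx := good_surv _ gx.
      have [Bx|Bx] := pselect (B (theta x n)); [left|right]; split=> // Mx;
      by apply: nS; split => //; first [by left|by right].
  apply: (le_trans (measureU2 P mD1 mD2)).
  by apply: (le_trans (leeD (eq_le0 _ N1) (eq_le0 _ N2))); rewrite adde0.
- move=> z [M1z|M2z].
    by have [x [gx Bx] xz] := M1A _ M1z; exists x.
  have [x [gx nBx] xz] := M2A _ M2z; exists x; split => //; split => [M1z|//].
  have [y [gy By] yz] := M1A _ M1z.
  (* Injectivity of T^m on surviving rows keeps the two image parts disjoint. *)
  have xy : x = y.
    apply: (iter_Tmap_inj F m); [exact: good_surv|exact: good_surv|].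
    by rewrite xz yz.
  by move: nBx; rewrite xy.
Qed.

(** * Approximating an event right of the cut by the past *)

Hypothesis dual_uniq : exists a0 : seqZ X0, exists2 V : set (seqZ X0),
  measurable V /\ P V = 1%E &
  forall z, V z -> Xstar F (mix left_of a0 z) /\
    forall xs us, family_ok F (mix left_of a0 z) xs us ->
      forall k, c <= k -> at_most_one_dual_orbit F (us k).

(** With the left half frozen to [a0], u_c^t depends on [a0] alone for t >= 0 and is that of the
    original row for t < 0. Equal pasts thus give equal u_c, and dual uniqueness carries this over
    to all columns on the right. *)
Lemma past_determines_right a0 z z' xs us xs' us' :
  Xstar F z -> Xstar F z' -> family_ok F z xs us -> family_ok F z' xs' us' ->
  Xstar F (mix left_of a0 z) -> Xstar F (mix left_of a0 z') ->
  (forall ys vs, family_ok F (mix left_of a0 z) ys vs ->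
    forall k, c <= k -> at_most_one_dual_orbit F (vs k)) ->
  (forall t, t < 0 -> us c t = us' c t) ->
  forall n, right_of n -> z n = z' n.
Proof.
move=> Sz Sz' ok ok' Sa Sa' one uu.
have [ys [vs [oka _]]] := Sa; have [ys' [vs' [oka' _]]] := Sa'.
have mr y n : right_of n -> mix left_of a0 y n = y n.
  by rewrite /right_of /mix /left_of => nc; rewrite leNgt nc.
have ml y y' n : left_of n -> mix left_of a0 y n = mix left_of a0 y' n.
  by rewrite /mix => ->.
have vv : vs c = vs' c.
  apply/funext => t; have [t0|t0] := leP 0 t.
    by have [] := upper_left_determined _ c _ _ _ _ _ _ Sa oka oka' (ml z z') c t
      (lexx c) t0.
  rewrite (lower_right_determined _ Finv c _ _ _ _ _ _ Sa oka ok (mr z) c t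
    (lexx c) t0).
  rewrite (lower_right_determined _ Finv c _ _ _ _ _ _ Sa' oka' ok' (mr z') c t
    (lexx c) t0).
  exact: uu.
move=> n nc; rewrite -(mr z)// -(mr z')//.
exact: (dual_columns_determined _ c _ _ _ _ _ _ oka oka' (one _ _ oka) vv).
Qed.

(** [B] combines finitely many events of u_c at ages between 1 and m. Seen m steps later they
    concern times 0 to m - 1, which the left half of x determines; [C] is the same combination
    evaluated on [reset x], so it depends on the left half exactly. *)
Lemma right_event_approx_future (A : set (seqZ X0)) (e : R) : measurable A ->
  (forall x y : seqZ X0, (forall n, right_of n -> x n = y n) -> A x -> A y) ->
  0 < e -> exists (B : set (seqZ X0)) (m : nat) (C : set (seqZ X0)),
    [/\ measurable B, measurable C,
    (P (A `\` B) <= e%:E)%E /\ (P (B `\` A) <= e%:E)%E,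
    forall x y : seqZ X0, (forall n, left_of n -> x n = y n) -> C x -> C y &
    exists H : set (seqZ X0), [/\ measurable H, P H = 1%E, H `<=` surv &
      forall x, H x -> (B (Tn m x) <-> C x)]].
Proof.
move=> mA hA e0.
have [ O' [oO sepO]] := polish_separating polX.
(* A code holds an age minus one, a site offset and the index of a separating open set. The
   successor in [tm] makes the time strictly negative, and c + 1 in [col] puts the site right of the
   cut. *)
pose idx j : nat * nat * nat := odflt (0, 0, 0)%N (unpickle j).
pose tm j := (idx j).1.1.+1.
pose col j : int := c + 1 + (idx j).1.2%:Z.
pose nb j := (idx j).2.
have bO j : borel_sets (O' (nb j)) by exact: open_borel.
have /choice [DR hDR] j := past_event (tm j) (col j) _ (bO j).
pose D j := (DR j).1.
have mD j : measurable (D j) by have [] := hDR j.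
have mR j : measurable (DR j).2 by have [] := hDR j.
have R1 j : P (DR j).2 = 1%E by have [] := hDR j.
have hD j z : (DR j).2 z -> exists x,
    [/\ good x, Tn (tm j) x = z & D j z <-> O' (nb j) (theta x (col j))].
  by have [_ _ _] := hDR j; apply.
have mRR : measurable (\bigcap_j (DR j).2) by exact: bigcapT_measurable.
have RR1 : P (\bigcap_j (DR j).2) = 1%E by exact: prob_full_bigcap.
have [a0 [V [mV V1] hV]] := dual_uniq.
pose G := (\bigcap_j (DR j).2) `&` V `&` surv.
have mG : measurable G.
  by apply: measurableI; [exact: measurableI|exact: surv_measurable].
have G1 : P G = 1%E.
  apply: prob_full_setI => //; [exact: measurableI|exact: surv_measurable| |].
    exact: prob_full_setI.
  exact: surv_full.
(* Agreement on all [D j] gives equal [theta] at every past time, hence equal past u_c, hence equal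
   rows right of c. *)
have sep z z' : G z -> G z' -> (forall j, D j z <-> D j z') -> A z -> A z'.
  move=> [[Rz Vz] Sz] [[Rz' Vz'] Sz'] Dz; apply: hA.
  have Xz := survives_Xstar _ _ Sz; have Xz' := survives_Xstar _ _ Sz'.
  have [xs [us [ok _]]] := Xz; have [xs' [us' [ok' _]]] := Xz'.
  have [Sa ha] := hV _ Vz; have [Sa' _] := hV _ Vz'.
  apply: (past_determines_right a0 _ _ _ _ _ _ Xz Xz' ok ok' Sa Sa' ha) => t t0.
  have [m tE] : exists m : nat, t = - m.+1%:Z.
    by exists (absz t).-1; lia.
  have pk k i : let j := pickle (m, k, i) in
      [/\ tm j = m.+1, col j = c + 1 + k%:Z & nb j = i].
    by rewrite /= /tm /col /nb /idx pickleK.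
  have [x [gx xz _]] := hD (pickle (m, 0, 0)%N) z (Rz _ I).
  have [x' [gx' xz' _]] := hD (pickle (m, 0, 0)%N) z' (Rz' _ I).
  have [tm0 _ _] := pk 0%N 0%N; rewrite tm0 in xz xz'.
  have tt n : right_of n -> theta x n = theta x' n.
    move=> nc; apply: sepO => i; pose k := absz (n - c - 1)%R.
    have [tmj colj nbj] := pk k i; set j := pickle _ in tmj colj nbj.
    have [y [gy]] := hD j z (Rz _ I); have [y' [gy']] := hD j z' (Rz' _ I).
    rewrite tmj colj nbj -[in X in X -> _]xz' => /iter_Tmap_inj yx'.
    rewrite yx'; [|exact: good_surv|exact: good_surv] => Dz'.
    rewrite -[in X in X -> _]xz => /iter_Tmap_inj yx.
    rewrite yx; [|exact: good_surv|exact: good_surv] => Dz0.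
    have nE : c + 1 + k%:Z = n by rewrite /k; move: nc; rewrite /right_of; lia.
    by rewrite nE in Dz' Dz0; rewrite -Dz0 -Dz'; exact: Dz.
  have Sx := good_surv _ gx; have Sx' := good_surv _ gx'.
  have Xx := survives_Xstar _ _ Sx; have Xx' := survives_Xstar _ _ Sx'.
  have [ws [vs [okx _]]] := Xx; have [ws' [vs' [okx' _]]] := Xx'.
  (* [x] is the row of [z] at time - m - 1, so its u_c^0 is the u_c of [z] at that time. *)
  have e1 := theta_determines_u _ _ _ _ _ _ Xx Xx' okx okx'
    (good_reset_surv 0 _ gx) (good_reset_surv 0 _ gx') tt.
  have := family_time_shift _ m.+1%:Z _ _ _ okx.
  rewrite -(iter_Tmap_family _ m.+1 _ _ _ Sx okx) xz => ok2.
  have := family_time_shift _ m.+1%:Z _ _ _ okx'.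
  rewrite -(iter_Tmap_family _ m.+1 _ _ _ Sx' okx') xz' => ok2'.
  have [_ ->] := family_unique _ _ _ _ _ _ Xz ok ok2.
  have [_ ->] := family_unique _ _ _ _ _ _ Xz' ok' ok2'.
  by rewrite tE addNr.
have [k [S [AB BA]]] := separated_event_approx polX P A G D e mA mG mD G1 sep e0.
have [m hm] : exists m, forall j, (j < k)%N -> (tm j <= m)%N.
  exists (\max_(j < k) tm j)%N => j jk.
  exact: (leq_bigmax (Ordinal jk)).
(* [D' j] is [D j] at time m, rewritten through [theta] at time m - [tm j] >= 0. *)
pose D' j : set (seqZ X0) := good `&`
  Tn (m - tm j) @^-1` (good `&` [set y | O' (nb j) (theta y (col j))]).
have mD' j : measurable (D' j).
  rewrite (_ : D' j = good `&` (surv `&` Tn (m - tm j) @^-1`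
    (good `&` [set y | O' (nb j) (theta y (col j))]))).
    apply: measurableI; first exact: good_measurable.
    by apply: surv_preimage_measurable; exact: theta_event_measurable.
  apply/seteqP; split => x; last by move=> [gx [_ ?]].
  by move=> [gx ?]; split => //; split => //; exact: good_surv.
pose C := reset @^-1` [set x | S (event_code D' k x)].
exists [set x | S (event_code D k x)], m, C; split => //.
- exact: measurable_event_code.
- by apply: reset_preimage_measurable; exact: measurable_event_code.
- by move=> x y xy; rewrite /C /= (reset_left _ _ xy).
exists (good `&` (surv `&` Tn m @^-1` (\bigcap_j (DR j).2))).
have mm := surv_preimage_measurable m _ mRR.
have mg := good_measurable.
split.
- exact: measurableI.
- by apply: prob_full_setI => //; [exact: good_full|rewrite surv_preimage_prob].
- by move=> x [_ []].
move=> x [gx [Sx Rx]]; rewrite /C /=.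
suff -> : event_code D k (Tn m x) = event_code D' k (reset x) by [].
apply/eq_in_map => j; rewrite mem_iota add0n => /andP[_ jk].
apply: asbool_equiv_eq.
have [y [gy yx ->]] := hD j _ (Rx j I).
(* The row [tm j] steps before T^m x is unique among surviving rows, and T^(m - [tm j]) x is one. *)
have yE : y = Tn (m - tm j) x.
  apply: (iter_Tmap_inj F (tm j)).
  - exact: good_surv.
  - exact: survives_iter (good_surv _ gx).
  - by rewrite yx -iterD subnKC// hm.
have -> : theta y = theta (Tn (m - tm j) (reset x)).
  by rewrite /theta iter_reset// yE.
split => [Ox|[_ []//]]; split; first exact: good_reset.
by split => //; apply: good_iter; exact: good_reset.
Qed.

End Cut.

End Dynamics.

(** * Ergodicity *)

Lemma cut_below (k : nat) (f : nat -> int) :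
  exists c : int, forall j, (j < k)%N -> c < f j.
Proof.
elim: k => [|k [c hc]]; first by exists 0.
exists (Num.min c (f k - 1)) => j; rewrite ltnS leq_eqVlt => /predU1P[->|/hc]; lia.
Qed.

(** Coordinate events of separating open sets distinguish all sequences, so finitely many of them
    approximate [A]; [c] lies below every coordinate involved. *)
Lemma finite_window_approx {R : realType} {X : ptopologicalType}
    (polX : polish R X) (P : probability (seqZ X) R) (A : set (seqZ X)) (e : R) :
  measurable A -> 0 < e -> exists (c : int) (A0 : set (seqZ X)),
    [/\ measurable A0, (P (A `\` A0) <= e%:E)%E, (P (A0 `\` A) <= e%:E)%E &
    forall x y : seqZ X, (forall n, c < n -> x n = y n) -> A0 x -> A0 y].
Proof.
move=> mA e0; have [ O' [oO sepO]] := polish_separating polX.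
pose idx j : int * nat := odflt (0, 0%N) (unpickle j).
pose D j : set (seqZ X) := [set x | O' (idx j).2 (x (idx j).1)].
have mD j : measurable (D j) by apply: measurable_coord; apply: open_borel.
have [||k [S [AB BA]]] := separated_event_approx polX P A setT D e mA
  measurableT mD _ _ e0; first exact: probability_setT.
  move=> x y _ _ xy; suff -> : x = y by [].
  apply/funext => n; apply: sepO => i.
  by have := xy (pickle (n, i)); rewrite /D /idx pickleK.
have [c hc] := cut_below k (fun j => (idx j).1).
exists c, [set x | S (event_code D k x)]; split => //.
  exact: measurable_event_code.
move=> x y xy /=; suff -> : event_code D k x = event_code D k y by [].
apply/eq_in_map => j; rewrite mem_iota add0n => /andP[_ jk].
by rewrite /D /= xy //; exact: hc.
Qed.

Lemma prob_diff_le {d} {T : measurableType d} {R : realType}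
    (P : probability T R) (A B : set T) (e : R) :
  measurable A -> measurable B -> (P (A `\` B) <= e%:E)%E ->
  fine (P A) <= fine (P B) + e.
Proof.
move=> mA mB AB; rewrite -lee_fin EFinD !fineK ?fin_num_measure//.
rewrite (measureDI P mA mB) addeC; apply: leeD => //.
by apply: le_prob => //; exact: measurableI.
Qed.

Lemma prob_fine01 {d} {T : measurableType d} {R : realType}
    (P : probability T R) (A : set T) : measurable A -> 0 <= fine (P A) <= 1.
Proof.
move=> mA; rewrite fine_ge0//= -lee_fin fineK ?fin_num_measure//.
exact: probability_le1.
Qed.

Lemma sqr_approx {R : realType} (a a0 b e : R) : 0 < e ->
  0 <= a <= 1 -> 0 <= a0 <= 1 -> a0 <= a + e -> a <= a0 + e ->
  a0 <= b + e -> b <= a0 + e -> a <= a0 * b + 3 * e -> a0 * b <= a + e ->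
  `|a - a * a| <= 6 * e.
Proof.
move=> e0 /andP[a_ge a_le] /andP[a0_ge a0_le] h1 h2 h3 h4 h5 h6.
(* a - a * a = (a - a0 * b) + a0 * (b - a) + a * (a0 - a), with bounds 3 e, 2 e and e for the three
   terms. *)
have k1 : a0 * (b - a) <= 2 * e by nra.
have k2 : - (2 * e) <= a0 * (b - a) by nra.
have k3 : a * (a0 - a) <= e by nra.
have k4 : - e <= a * (a0 - a) by nra.
by rewrite ler_norml; apply/andP; split; nra.
Qed.

Lemma dual_uniq_shifted {R : realType} {X0 : ptopologicalType} {U0 : Type}
    (F : X0 * U0 -> X0 * U0)
    (mu : probability (borelT X0) R) (P : probability (seqZ X0) R)
    (c : int) (w : pred int) :
  is_product_measure mu P -> measurable (Xstar F : set (seqZ X0)) ->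
  P (Xstar F) = 1%E ->
  {ae P, forall x : seqZ X0, Xstar F x ->
     forall xs us, family_ok F x xs us -> at_most_one_dual_orbit F (us 0)} ->
  exists a0 : seqZ X0, exists2 V : set (seqZ X0),
    measurable V /\ P V = 1%E &
    forall z, V z -> Xstar F (mix w a0 z) /\
      forall xs us, family_ok F (mix w a0 z) xs us ->
        forall k, c <= k -> at_most_one_dual_orbit F (us k).
Proof.
move=> Pprod mS S1 [N [mN N0 hN]].
pose V j : set (seqZ X0) := spatial_shift (c + j%:Z) @^-1` (~` N).
have mNC : measurable (~` N) by exact: measurableC.
have mV j : measurable (V j).
  by rewrite -[X in measurable X]setTI; exact: measurable_spatial_shift.
have V1 j : P (V j) = 1%E.
  rewrite (spatial_shift_law mu)//.
  by apply/(prob_full_setC P _ mNC); rewrite setCK.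
have mW : measurable (Xstar F `&` \bigcap_j V j : set (seqZ X0)).
  by apply: measurableI => //; exact: bigcapT_measurable.
have [|a0 ha0] := mix_full_right mu P Pprod w _ mW.
  by apply: prob_full_setI => //; [exact: bigcapT_measurable|
    exact: prob_full_bigcap].
exists a0, (mix w a0 @^-1` (Xstar F `&` \bigcap_j V j)).
  split => //; rewrite -[X in measurable X]setTI.
  by apply: (measurable_mixr w a0).
move=> z [Sz Vz]; split => // xs us ok k ck.
have [j kE] : exists j : nat, k = c + j%:Z by exists (absz (k - c)%R); lia.
have /contrapT := contra_not (hN (spatial_shift k (mix w a0 z)))
  ltac:(by rewrite kE; exact: (Vz j I)).
move=> /(_ (Xstar_spatial_shift F k _ Sz) _ _ (family_spatial_shift F k _ _ _ ok)).
by rewrite add0r.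
Qed.

Theorem theorem2p11 (R : realType) (X0 : ptopologicalType) (U0 : topologicalType)
    (F : X0 * U0 -> X0 * U0)
    (polX : polish R X0) (polU : polish R U0)
    (Finv : forall p, F (F p) = p)
    (mu : probability (borelT X0) R) (P : probability (seqZ X0) R)
    (Pprod : is_product_measure mu P)
    (Xstar_meas : measurable (Xstar F : set (seqZ X0)))
    (Xstar_full : P (Xstar F) = 1%E)
    (T_meas : measurable_fun (Xstar F : set (seqZ X0))
                (Tmap F : seqZ X0 -> seqZ X0))
    (T_inv : forall A : set (seqZ X0), measurable A ->
        P (Xstar F `&` Tmap F @^-1` A) = P A)
    (uniq_dual : {ae P, forall x : seqZ X0, Xstar F x ->
        forall xs us, family_ok F x xs us -> at_most_one_dual_orbit F (us 0)}) :
  forall A : set (seqZ X0), measurable A ->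
    Xstar F `&` Tmap F @^-1` A = Xstar F `&` A ->
    P A = 0%E \/ P A = 1%E.
Proof.
move=> A mA invA.
have inv1 x : Xstar F x -> (A (Tmap F x) <-> A x).
  move=> Sx; have := congr1 (@^~ x) invA => /= ee.
  by split => Ax; [have [] : (Xstar F `&` A) x by rewrite -invA|
    have [] : (Xstar F `&` Tmap F @^-1` A) x by rewrite invA].
have invm m x : survives F x -> (A (iter m (Tmap F) x) <-> A x).
  by move=> Sx; elim: m => [//|m IH] /=; rewrite -IH; exact: inv1.
have mS := surv_measurable F Xstar_meas T_meas.
have S1 := surv_full F P Xstar_meas Xstar_full T_meas T_inv.
pose a := fine (P A).
have [a_ge a_le] := andP (prob_fine01 P A mA).
suff approx e : 0 < e -> `|a - a * a| <= 6 * e.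
  have /eqP : a - a * a = 0.
    apply/normr0_eq0/le_anti/andP; split => //; apply/ler_addgt0Pr => e e0.
    rewrite add0r; have e6 : 0 < e / 6 by rewrite divr_gt0.
    by apply: (le_trans (approx _ e6)); rewrite mulrC divfK.
  rewrite -{1}[a]mulr1 -mulrBr mulf_eq0 subr_eq0 =>
    /orP[/eqP a0|/eqP a1]; [left|right].
    by rewrite -[P A]fineK ?fin_num_measure// -/a a0.
  by rewrite -[P A]fineK ?fin_num_measure// -/a -a1.
move=> e0.
have [c [A0 [mA0 AA0 A0A hA0]]] := finite_window_approx polX P A e mA e0.
pose w : pred int := fun n => n <= c.
(* [b0] is the right half to which [reset] returns; almost every left half completed by it
   survives. *)
have [b0 hb0] := mix_full_left mu P Pprod w _ mS S1.
have dual := dual_uniq_shifted F mu P c w Pprod Xstar_meas Xstar_full uniq_dual.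
have [B [m [C [mB mC [A0B BA0] hC [H [mH H1 HS HBC]]]]]] :=
  right_event_approx_future F polX Finv P Xstar_meas Xstar_full T_meas T_inv
    c b0 hb0 dual A0 e mA0 hA0 e0.
pose pre (E : set (seqZ X0)) : set (seqZ X0) :=
  [set x | survives F x] `&` (iter m (Tmap F) : seqZ X0 -> seqZ X0) @^-1` E.
have mpre E : measurable E -> measurable (pre E).
  exact: (surv_preimage_measurable F Xstar_meas T_meas m E).
have Ppre E : measurable E -> P (pre E) = P E.
  exact: (surv_preimage_prob F P Xstar_meas Xstar_full T_meas T_inv m E).
(* Almost surely [C] is the event that T^m x lies in [B], and T preserves [P]. *)
have PC : P C = P B.
  rewrite -(Ppre B mB) -(prob_setI_full P C H)// -(prob_setI_full P (pre B) H)//;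
    last exact: mpre.
  congr (P _); apply/seteqP; split => x [Cx Hx]; split => //.
    by split; [exact: HS|apply/HBC].
  by apply/HBC => //; case: Cx.
have indep : P (A0 `&` C) = (P A0 * P B)%E.
  rewrite setIC -PC muleC; apply: (mix_indep mu P Pprod w) => // x y xy.
  by apply: hA0 => n nc; apply: xy; rewrite /w -ltNge.
have mAC : measurable (A0 `&` C) by exact: measurableI.
(* By invariance T^m x lies in [A] with x, so there are three losses of at most e: x misses [A0],
   T^m x misses [A0], or T^m x lies in [A0] but not in [B]. *)
have low : (P (A `\` (A0 `&` C)) <= (3 * e)%:E)%E.
  have m1 : measurable (A `\` A0) by exact: measurableD.
  have m2 : measurable (A0 `\` B) by exact: measurableD.
  have m1' := mpre _ m1; have m2' := mpre _ m2.
  apply: (@le_trans _ _ (P ((A `\` A0) `|` (pre (A `\` A0) `|` pre (A0 `\` B))))).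
    apply: (prob_le_off_null P _ _ H) => //; first exact: measurableD.
      by do ! apply: measurableU => //.
    move=> x [[Ax nAC] Hx]; have Sx := HS _ Hx.
    have [A0x|nA0] := pselect (A0 x); last by left.
    have nB : ~ B (iter m (Tmap F) x).
      by move=> /(HBC x Hx) Cx; apply: nAC.
    have AT := (invm m x Sx).2 Ax.
    by have [A0T|nA0T] := pselect (A0 (iter m (Tmap F) x)); right; [right|left].
  apply: (le_trans (measureU2 P m1 (measurableU _ _ m1' m2'))).
  rewrite (_ : 3 * e = e + (e + e)); last by ring.
  rewrite EFinD; apply: leeD => //; apply: (le_trans (measureU2 P m1' m2')).
  rewrite EFinD; apply: leeD.
    by apply: le_trans AA0; rewrite -(Ppre _ m1).
  by apply: le_trans A0B; rewrite -(Ppre _ m2).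
have up : (P ((A0 `&` C) `\` A) <= e%:E)%E.
  apply: le_trans A0A; apply: le_prob; [exact: measurableD|exact: measurableD|].
  by move=> x [[]].
have prod : fine (P (A0 `&` C)) = fine (P A0) * fine (P B).
  by rewrite indep fineM ?fin_num_measure.
have := prob_diff_le P _ _ _ mAC mA up; have := prob_diff_le P _ _ _ mA mAC low.
rewrite prod => h1 h2.
apply: (sqr_approx a (fine (P A0)) (fine (P B)) e) => //; try exact: prob_fine01;
  by apply: prob_diff_le.
Qed.
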